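(* Let $E$ be a Banach space with non-trivial type. There is a constant $C>0$, depending only on $E$, such that for every $p\in(0,1]$, every operator $T:E\to X$, where $X$ is a $p$-convex $p$-Banach lattice, admits a unique extension to a lattice homomorphism $\widehat T:\mathrm{FBL}[E]\to X$ (that is, $\widehat T\delta=T$), and $\|\widehat T\|\le C\cdot M^{(p)}(X)\cdot\|T\|$.
   Context: All spaces are real; operators are continuous linear maps. For $p\in(0,1]$, a $p$-Banach lattice is a vector lattice complete for a $p$-norm (definite, homogeneous, $\|x+y\|^p\le\|x\|^p+\|y\|^p$) with $|x|\le|y|\Rightarrow\|x\|\le\|y\|$. It is $p$-convex if there is $C>0$ with $\|(\sum_{k=1}^n|x_k|^p)^{1/p}\|\le C(\sum_{k=1}^n\|x_k\|^p)^{1/p}$ for all finite families; the infimum of such $C$ is $M^{(p)}(X)$. Non-trivial type means Rademacher type $q$ for some $q>1$. $\mathrm{FBL}[E]$ is the free Banach lattice generated by the Banach space $E$: a Banach lattice with a linear isometric embedding $\delta:E\to\mathrm{FBL}[E]$ such that every operator $T$ from $E$ to a Banach lattice $X$ admits a unique lattice homomorphism $\widehat T:\mathrm{FBL}[E]\to X$ with $\widehat T\delta=T$, and $\|\widehat T\|=\|T\|$. *)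

(* Defs.v *)
From HB Require Import structures.
From mathcomp Require Import all_boot all_order all_algebra.
From mathcomp Require Import all_classical all_reals all_analysis.

Set Implicit Arguments.
Unset Strict Implicit.
Unset Printing Implicit Defensive.

Import Order.TTheory GRing.Theory Num.Theory.
Import numFieldNormedType.Exports.

Local Open Scope classical_set_scope.
Local Open Scope ring_scope.

(* Joining GRing.Lmodule with Order.Lattice is rejected by Hierarchy-Builder
   (Num.RealDomain already inherits from both Order.Lattice and GRing.Zmodule
   without a named join), so the binary suprema and infima of the partial order
   are given here. *)
HB.mixin Record POrderedLmodule_isVectorLattice (R : numDomainType) V
    of GRing.Lmodule R V & Num.POrderedZmodule V := {
  vjoin : V -> V -> V;
  vmeet : V -> V -> V;
  vjoin_le : forall x y z : V, (vjoin x y <= z) = (x <= z) && (y <= z);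
  le_vmeet : forall x y z : V, (z <= vmeet x y) = (z <= x) && (z <= y);
  vl_leD2r : forall x y z : V, x <= y -> x + z <= y + z;
  vl_leZ : forall (a : R) (x y : V), 0 <= a -> x <= y -> a *: x <= a *: y
}.

#[short(type="vectorLatticeType")]
HB.structure Definition VectorLattice (R : numDomainType) :=
  {V of GRing.Lmodule R V & Num.POrderedZmodule V
      & POrderedLmodule_isVectorLattice R V}.

Definition vabs (R : numDomainType) (V : vectorLatticeType R) (x : V) : V :=
  vjoin x (- x).

(* The structure makes sense for every p; users have to assume 0 < p <= 1.
   Banach lattices are the case p = 1. *)
HB.mixin Record VectorLattice_isPBanach (R : realType) (p : R) X
    of VectorLattice R X & Uniform X := {
  pnorm : X -> R;
  pnorm_ge0 : forall x : X, 0 <= pnorm x;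
  pnorm_eq0 : forall x : X, pnorm x = 0 -> x = 0;
  pnormZ : forall (a : R) (x : X), pnorm (a *: x) = `|a| * pnorm x;
  pnormD : forall x y : X,
    pnorm (x + y) `^ p <= pnorm x `^ p + pnorm y `^ p;
  pnorm_solid : forall x y : X, vabs x <= vabs y -> pnorm x <= pnorm y;
  pnorm_entourageE :
    entourage = entourage_ (fun (x : X) (e : R) => [set y | pnorm (x - y) < e]);
  pnorm_complete : forall F : set_system X,
    ProperFilter F -> cauchy F -> exists l : X, F --> l
}.

#[short(type="pBanachLatticeType")]
HB.structure Definition PBanachLattice (R : realType) (p : R) :=
  {X of VectorLattice R X & Uniform X & VectorLattice_isPBanach R p X}.

Definition lattice_hom (R : numDomainType) (V W : vectorLatticeType R)
    (S : V -> W) : Prop :=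
  [/\ linear S,
      {morph S : x y / vjoin x y} &
      {morph S : x y / vmeet x y}].

(* Extended real valued, so that an unbounded map has norm +oo (the supremum of
   an unbounded set of reals would be 0). *)
Definition opnorm (R : realType) (U V : Type) (nU : U -> R) (nV : V -> R)
    (S : U -> V) : \bar R :=
  ereal_sup [set (nV (S x))%:E | x in [set x | nU x <= 1]].

Section Krivine.
Context (R : realType).

Definition pos_homog_cont n (h : 'rV[R]_n -> R) : Prop :=
  continuous h /\
  forall (a : R) (t : 'rV[R]_n), 0 <= a -> h (a *: t) = a * h t.

(* Krivine's functional calculus at x_1, ..., x_n: a lattice homomorphism from
   the vector lattice of positively homogeneous continuous functions on R^n
   that maps the k-th coordinate function to x_k. Values of Phi on other
   functions are irrelevant. In a p-Banach lattice (Archimedean and uniformly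
   complete) it exists and is unique on those functions. *)
Definition krivine_calculus (X : vectorLatticeType R) n (x : 'I_n -> X)
    (Phi : ('rV[R]_n -> R) -> X) : Prop :=
  (forall k, Phi (fun t => t ord0 k) = x k) /\
  forall g h, pos_homog_cont g -> pos_homog_cont h ->
    [/\ forall a : R, Phi (fun t => a * g t + h t) = a *: Phi g + Phi h,
        Phi (fun t => Num.max (g t) (h t)) = vjoin (Phi g) (Phi h) &
        Phi (fun t => Num.min (g t) (h t)) = vmeet (Phi g) (Phi h)].

Definition krivine (X : vectorLatticeType R) n (x : 'I_n -> X)
    (h : 'rV[R]_n -> R) : X :=
  xget 0 [set y | exists2 Phi, krivine_calculus x Phi & y = Phi h].

Definition lp_fun (p : R) n (t : 'rV[R]_n) : R :=
  (\sum_(k < n) `|t ord0 k| `^ p) `^ p^-1.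

End Krivine.

Section PConvexity.
Context (R : realType) (p : R) (X : pBanachLatticeType p).

Definition p_convex_const (C : R) : Prop :=
  0 < C /\
  forall n (x : 'I_n -> X),
    pnorm (krivine x (@lp_fun R p n))
      <= C * (\sum_(k < n) pnorm (x k) `^ p) `^ p^-1.

Definition p_convex : Prop := exists C, p_convex_const C.

Definition p_convexity_const : R := inf [set C | p_convex_const C].

End PConvexity.

Definition rademacher_type (R : realType) (E : normedModType R) (q : R) : Prop :=
  exists K : R, forall n (x : 'I_n -> E),
    ((2 ^+ n)^-1 *
       \sum_(s : {ffun 'I_n -> bool}) `|\sum_(k < n) (-1) ^+ s k *: x k| `^ q)
      `^ q^-1
    <= K * (\sum_(k < n) `|x k| `^ q) `^ q^-1.

Definition nontrivial_type (R : realType) (E : normedModType R) : Prop :=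
  exists2 q : R, 1 < q & rademacher_type E q.

Definition lattice_hom_extension (R : realType) (E : Type)
    (F X : vectorLatticeType R) (delta : E -> F) (T : E -> X) (S : F -> X) :=
  lattice_hom S /\ forall x, S (delta x) = T x.

Definition is_FBL (R : realType) (E : completeNormedModType R)
    (F : pBanachLatticeType (1 : R)) (delta : {linear E -> F}) : Prop :=
  (forall x, pnorm (delta x) = `|x|) /\
  forall (X : pBanachLatticeType (1 : R)) (T : {linear E -> X}), continuous T ->
    exists That : F -> X,
      unique (lattice_hom_extension delta T) That /\
      opnorm pnorm pnorm That = opnorm Num.norm pnorm T.

(* Main.v *)
Require Import Defs.
From HB Require Import structures.
From mathcomp Require Import all_boot all_order all_algebra.
From mathcomp Require Import all_classical all_reals all_analysis.
From mathcomp Require Import ring lra.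
Set Implicit Arguments.
Unset Strict Implicit.
Unset Printing Implicit Defensive.
Import Order.TTheory GRing.Theory Num.Theory.
Import numFieldNormedType.Exports.
Local Open Scope classical_set_scope.
Local Open Scope ring_scope.

(** Let [T : E -> X] be bounded, with values in a p-convex lattice. The universal
    property of the free lattice concerns Banach lattices, so [T] has to be
    factored through one. The natural candidate is the ideal of [X] whose unit
    ball is the closed solid convex hull of the image under [T] of the unit ball
    of [E] ([gauge_ideal]). Its gauge is a complete lattice norm with
    [pnorm <= c * gauge] as soon as [T] satisfies
      pnorm (sum_k |T x_k|) <= c * sum_k |x_k|
    for all finite families; the extension then has norm at most [c].

    This inequality, with [c = C * M * t] where [t] is the norm of [T] and [M]
    the p-convexity constant, is [nontrivial_type_convex]. It suffices to find
    finitely many linear combinations [y_j] of the [x_k] such that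
    sum_k |a_k| <= (sum_j |A_j a|^p)^(1/p) for all real [a], where the [A_j] are
    the corresponding forms, while (sum_j |y_j|^p)^(1/p) <= C * sum_k |x_k|
    ([type_forms]). Indeed the first inequality passes from the reals to [X] by
    Krivine's functional calculus ([vl1_le_krivine]), then p-convexity applies to
    the family [T y_j]. The [y_j] are the values of a random combination of the
    [x_k] modelled on LePage's representation of a 1-stable variable: normalised
    vectors are picked independently with probabilities proportional to their
    norms, and added with weights [u_i / (i + 1)], where the [u_i] are uniform in
    [-1, 1]. Since the weights [1 / (i + 1)] are q-summable, type [q > 1] bounds
    the mean norm. The lower bound has to be uniform when [p] tends to 0; it comes
    from a moment of order -1/2 ([lepage_neg_moment]), which bounds every L_p-norm
    from below with a constant independent of [p] ([neg_moment_powR]). All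
    probability spaces are finite, at the price of a regularisation by small
    multiples of the coordinates.

    Functional calculus exists in [X] because a lattice-linear inequality that
    holds in the reals holds in every vector lattice: after reduction to meets of
    joins of linear forms, Fourier-Motzkin elimination proves it
    ([fourier_motzkin], [mterm_ge0]). Continuous positively homogeneous functions
    are limits of lattice-linear ones ([mterm_dense]).

    Uniqueness is not part of the universal property either, since [X] is not a
    Banach lattice. Lattice homomorphisms on [F] are automatically bounded
    ([lattice_hom_bounded]), so two extensions coincide on a closed sublattice
    containing the range of [delta], and such a sublattice is all of [F]. *)

(** * Vector lattices *)

Section VectorLatticeTheory.
Context (R : realType) (V : vectorLatticeType R).
Implicit Types x y z u : V.

Lemma vleD2r z x y : (x + z <= y + z) = (x <= y).
Proof.
apply/idP/idP => [|h]; last exact: vl_leD2r.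
by move=> h; have := vl_leD2r _ _ (- z) h; rewrite !addrK.
Qed.

Lemma vleD2l z x y : (z + x <= z + y) = (x <= y).
Proof. by rewrite !(addrC z) vleD2r. Qed.

Lemma vsubr_ge0 x y : (0 <= y - x) = (x <= y).
Proof. by rewrite -(vleD2r x 0) add0r subrK. Qed.

Lemma vleD x y z u : x <= y -> z <= u -> x + z <= y + u.
Proof. by move=> xy zu; apply: (@le_trans _ _ (y + z)); rewrite ?vleD2r ?vleD2l. Qed.

Lemma vaddr_ge0 x y : 0 <= x -> 0 <= y -> 0 <= x + y.
Proof. by move=> x0 y0; rewrite -[0]addr0; exact: vleD. Qed.

Lemma vleN x y : (- x <= - y) = (y <= x).
Proof. by rewrite -(vleD2r (x + y) (- x)) addrA addNr add0r addrCA addNr addr0. Qed.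

Lemma vleNl x y : (- x <= y) = (- y <= x).
Proof. by rewrite -(vleN y) opprK. Qed.

Lemma vleBl x y z : (x - y <= z) = (x <= z + y).
Proof. by rewrite -(vleD2r y (x - y)) subrK. Qed.

Lemma vleBr x y z : (x <= z - y) = (x + y <= z).
Proof. by rewrite -(vleD2r y x (z - y)) subrK. Qed.

Lemma vleZ (a : R) x y : 0 <= a -> x <= y -> a *: x <= a *: y.
Proof. exact: vl_leZ. Qed.

Lemma vscale_ge0 (a : R) x : 0 <= a -> 0 <= x -> 0 <= a *: x.
Proof. by move=> a0 x0; rewrite -(scaler0 _ a); exact: vleZ. Qed.

Lemma vsum_ge0 (I : Type) (r : seq I) (F : I -> V) :
  (forall i, 0 <= F i) -> 0 <= \sum_(i <- r) F i.
Proof. by move=> F0; elim/big_ind: _ => // x y; exact: vaddr_ge0. Qed.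

Lemma vle_sum (I : Type) (r : seq I) (F G : I -> V) :
  (forall i, F i <= G i) -> \sum_(i <- r) F i <= \sum_(i <- r) G i.
Proof. by move=> FG; elim/big_ind2: _ => // *; exact: vleD. Qed.

Lemma vjoin_lel x y : x <= vjoin x y.
Proof. by have := vjoin_le x y (vjoin x y); rewrite lexx => /esym/andP[]. Qed.

Lemma vjoin_ler x y : y <= vjoin x y.
Proof. by have := vjoin_le x y (vjoin x y); rewrite lexx => /esym/andP[]. Qed.

Lemma vmeet_lel x y : vmeet x y <= x.
Proof. by have := le_vmeet x y (vmeet x y); rewrite lexx => /esym/andP[]. Qed.

Lemma vmeet_ler x y : vmeet x y <= y.
Proof. by have := le_vmeet x y (vmeet x y); rewrite lexx => /esym/andP[]. Qed.

Lemma vjoinP x y z : x <= z -> y <= z -> vjoin x y <= z.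
Proof. by move=> h1 h2; rewrite vjoin_le h1. Qed.

Lemma vmeetP x y z : z <= x -> z <= y -> z <= vmeet x y.
Proof. by move=> h1 h2; rewrite le_vmeet h1. Qed.

Lemma eq_vjoin x y z : (forall u, (z <= u) = (x <= u) && (y <= u)) -> z = vjoin x y.
Proof.
move=> h; apply/le_anti; rewrite h vjoin_lel vjoin_ler /=.
by have := h z; rewrite lexx => /esym/andP[? ?]; exact: vjoinP.
Qed.

Lemma eq_vmeet x y z : (forall u, (u <= z) = (u <= x) && (u <= y)) -> z = vmeet x y.
Proof.
move=> h; apply/le_anti; rewrite h vmeet_lel vmeet_ler /= andbT.
by have := h z; rewrite lexx => /esym/andP[? ?]; exact: vmeetP.
Qed.

Lemma vjoinC x y : vjoin x y = vjoin y x.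
Proof. by apply: eq_vjoin => u; rewrite vjoin_le andbC. Qed.

Lemma vmeetC x y : vmeet x y = vmeet y x.
Proof. by apply: eq_vmeet => u; rewrite le_vmeet andbC. Qed.

Lemma vjoinDr x y z : vjoin x y + z = vjoin (x + z) (y + z).
Proof. by apply: eq_vjoin => u; rewrite -!vleBr vjoin_le. Qed.

Lemma vmeetDr x y z : vmeet x y + z = vmeet (x + z) (y + z).
Proof. by apply: eq_vmeet => u; rewrite -!vleBl le_vmeet. Qed.

Lemma vjoinN x y : - vjoin x y = vmeet (- x) (- y).
Proof. by apply: eq_vmeet => u; rewrite -[u]opprK !vleN vjoin_le. Qed.

Lemma vmeetN x y : - vmeet x y = vjoin (- x) (- y).
Proof. by apply: eq_vjoin => u; rewrite -[u]opprK !vleN le_vmeet. Qed.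

Lemma vmeetE x y : vmeet x y = - vjoin (- x) (- y).
Proof. by rewrite vjoinN !opprK. Qed.

Lemma vscale_le_gt0 (a : R) x y : 0 < a -> (a *: x <= a *: y) = (x <= y).
Proof.
move=> a0; apply/idP/idP => h; last by apply: vleZ => //; exact: ltW.
have := @vleZ a^-1 _ _ _ h; rewrite !scalerA mulVf ?gt_eqF// !scale1r; apply.
by rewrite invr_ge0 ltW.
Qed.

Lemma vjoinZ (a : R) x y : 0 <= a -> a *: vjoin x y = vjoin (a *: x) (a *: y).
Proof.
rewrite le_eqVlt => /predU1P[<-|a0].
  by rewrite !scale0r; apply: eq_vjoin => u; rewrite andbb.
apply: eq_vjoin => u; rewrite -[u](@scalerKV _ _ a) ?gt_eqF//.
by rewrite !vscale_le_gt0// vjoin_le.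
Qed.

Lemma vmeetZ (a : R) x y : 0 <= a -> a *: vmeet x y = vmeet (a *: x) (a *: y).
Proof. by move=> a0; rewrite !vmeetE scalerN vjoinZ// !scalerN. Qed.

Lemma vjoin_meetD x y : vjoin x y + vmeet x y = x + y.
Proof.
rewrite vmeetE; apply/eqP; rewrite subr_eq; apply/eqP.
by rewrite [RHS]addrC vjoinDr addKr addrCA addNr addr0 vjoinC.
Qed.

(** The sum of join and meet turns a bound on [vmeet x v] into a bound on [v]
    itself, which reduces distributivity to the order. *)
Lemma vmeet_joinr x y z : vmeet x (vjoin y z) = vjoin (vmeet x y) (vmeet x z).
Proof.
apply/le_anti/andP; split; last first.
  by rewrite vjoin_le !le_vmeet !vmeet_lel/= !(le_trans (vmeet_ler _ _))
     ?vjoin_lel ?vjoin_ler.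
set u := vjoin (vmeet _ _) _; set w := vjoin x (vjoin y z).
have h v : v <= vjoin y z -> vmeet x v <= u -> v <= u + w - x.
  move=> vyz vu; rewrite vleBr [v + x]addrC -(vjoin_meetD x v) addrC; apply: vleD => //.
  by rewrite vjoin_le vjoin_lel (le_trans vyz)// vjoin_ler.
have : vjoin y z <= u + w - x.
  by apply: vjoinP; apply: h; rewrite ?vjoin_lel ?vjoin_ler.
rewrite vleBr -(vjoin_meetD (vjoin y z) x) (vjoinC _ x) -/w addrC vmeetC.
by rewrite vleD2r.
Qed.

Lemma vjoin_meetr x y z : vjoin x (vmeet y z) = vmeet (vjoin x y) (vjoin x z).
Proof.
have := vmeet_joinr (- x) (- y) (- z); rewrite -!(vjoinN, vmeetN).
by move/oppr_inj.
Qed.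

Lemma vjoin_l x y : y <= x -> vjoin x y = x.
Proof. by move=> yx; apply/le_anti; rewrite vjoin_lel vjoinP. Qed.

Lemma vabs_le x y : (vabs x <= y) = (x <= y) && (- x <= y).
Proof. exact: vjoin_le. Qed.

Lemma vle_abs x : x <= vabs x. Proof. exact: vjoin_lel. Qed.
Lemma vleN_abs x : - x <= vabs x. Proof. exact: vjoin_ler. Qed.

Lemma vabsN x : vabs (- x) = vabs x.
Proof. by rewrite /vabs opprK vjoinC. Qed.

Lemma vabs_ge0 x : 0 <= vabs x.
Proof.
rewrite -(@vscale_le_gt0 2)// scaler0 scaler_nat mulr2n -[0](subrr x).
by apply: vleD; [exact: vle_abs|exact: vleN_abs].
Qed.

Lemma vger0_abs x : 0 <= x -> vabs x = x.
Proof.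
move=> x0; apply: vjoin_l; rewrite (le_trans _ x0)//.
by rewrite vleNl oppr0.
Qed.

Lemma vabs_abs x : vabs (vabs x) = vabs x.
Proof. exact/vger0_abs/vabs_ge0. Qed.

Lemma vabs0 : vabs (0 : V) = 0. Proof. exact: vger0_abs. Qed.

Lemma vabsD x y : vabs (x + y) <= vabs x + vabs y.
Proof. by rewrite vabs_le opprD !vleD ?vle_abs ?vleN_abs. Qed.

Lemma vabs_distC x y : vabs (x - y) = vabs (y - x).
Proof. by rewrite -opprB vabsN. Qed.

Lemma vabsZ_ge0 (a : R) x : 0 <= a -> vabs (a *: x) = a *: vabs x.
Proof. by move=> a0; rewrite /vabs -scalerN -vjoinZ. Qed.

Lemma vabsZ (a : R) x : vabs (a *: x) = `|a| *: vabs x.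
Proof.
have [a0|a0] := ger0P a; first exact: vabsZ_ge0.
by rewrite -vabsN -scaleNr vabsZ_ge0// oppr_ge0 ltW.
Qed.

Lemma vabs_sum (I : Type) (r : seq I) (F : I -> V) :
  vabs (\sum_(i <- r) F i) <= \sum_(i <- r) vabs (F i).
Proof.
elim/big_ind2: _ => //; first by rewrite vabs0.
by move=> x y z u h1 h2; apply: le_trans (vabsD _ _) _; exact: vleD.
Qed.

Lemma vabs_joinB x y z u :
  vabs (vjoin x y - vjoin z u) <= vabs (x - z) + vabs (y - u).
Proof.
have h (a b c d : V) : vjoin a b - vjoin c d <= vabs (a - c) + vabs (b - d).
  rewrite vleBl vjoin_le; apply/andP; split.
    rewrite -[X in X <= _](subrK c) vleD ?vjoin_lel// -[X in X <= _]addr0.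
    by rewrite vleD ?vabs_ge0// vle_abs.
  rewrite -[X in X <= _](subrK d) vleD ?vjoin_ler// -[X in X <= _]add0r.
  by rewrite vleD ?vabs_ge0// vle_abs.
by rewrite vabs_le h/= opprB (vabs_distC x) (vabs_distC y) h.
Qed.

Lemma vabs_meetB x y z u :
  vabs (vmeet x y - vmeet z u) <= vabs (x - z) + vabs (y - u).
Proof.
rewrite !vmeetE -opprD vabsN; apply: le_trans (vabs_joinB _ _ _ _) _.
by rewrite -!opprD !vabsN.
Qed.

End VectorLatticeTheory.

(** * Powers with exponents in ]0, 1] and p-Banach lattices *)

Section PowR.
Context (R : realType).
Implicit Types x y p r : R.

Lemma powR_le r x y : 0 <= r -> 0 <= x -> x <= y -> x `^ r <= y `^ r.
Proof.
by move=> r0 x0 xy; apply: ge0_ler_powR; rewrite // nnegrE// (le_trans x0).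
Qed.

Lemma powR_invK p x : 0 < p -> 0 <= x -> (x `^ p) `^ p^-1 = x.
Proof. by move=> p0 x0; rewrite -powRrM mulfV ?gt_eqF// powRr1. Qed.

Lemma powR_Vinv p x : 0 < p -> 0 <= x -> (x `^ p^-1) `^ p = x.
Proof. by move=> p0 x0; rewrite -powRrM mulVf ?gt_eqF// powRr1. Qed.

Lemma powR_le_inv p x y : 0 < p -> 0 <= x -> x `^ p <= y -> x <= y `^ p^-1.
Proof.
move=> p0 x0 xy; rewrite -[leLHS](powR_invK p0 x0) powR_le ?powR_ge0//.
by rewrite invr_ge0 ltW.
Qed.

Lemma powR_cancel_le p x y : 0 < p -> 0 <= x -> 0 <= y ->
  x `^ p <= y `^ p -> x <= y.
Proof. by move=> p0 x0 y0 /(powR_le_inv p0 x0); rewrite powR_invK. Qed.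

(** Each summand [a] is the fraction [a / (x + y) <= 1] of the sum, and raising
    such a fraction to a power at most 1 increases it. *)
Lemma powR_leD p x y : 0 < p <= 1 -> 0 <= x -> 0 <= y ->
  (x + y) `^ p <= x `^ p + y `^ p.
Proof.
move=> /andP[p0 p1] x0 y0.
have := addr_ge0 x0 y0; rewrite le_eqVlt => /predU1P[<-|xy0].
  by rewrite powR0 ?gt_eqF// addr_ge0 ?powR_ge0.
have h (a : R) : 0 <= a -> a <= x + y -> a / (x + y) * (x + y) `^ p <= a `^ p.
  rewrite [0 <= a]le_eqVlt => /predU1P[<- _|a0 axy]; first by rewrite !mul0r powR_ge0.
  rewrite -[X in _ <= X `^ _](divfK (lt0r_neq0 xy0)) powRM ?divr_ge0 ?(ltW a0) ?(ltW xy0)//.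
  rewrite ler_pM2r ?powR_gt0//; apply: ger1_powR => //.
  by rewrite divr_gt0//= ler_pdivrMr// mul1r.
apply: (le_trans _ (lerD (h x x0 _) (h y y0 _))); rewrite ?lerDl ?lerDr//.
by rewrite -!mulrDl divff ?mul1r ?gt_eqF.
Qed.

End PowR.

Section PBanachTheory.
Context (R : realType) (p : R) (hp : 0 < p <= 1) (X : pBanachLatticeType p).
Implicit Types (x y z l : X) (u v : nat -> X).

Let p0 : 0 < p. Proof. by case/andP: hp. Qed.

Lemma pnorm0 : pnorm (0 : X) = 0.
Proof. by rewrite -(scale0r (0 : X)) pnormZ normr0 mul0r. Qed.

Lemma pnormN x : pnorm (- x) = pnorm x.
Proof. by rewrite -scaleN1r pnormZ normrN1 mul1r. Qed.

Lemma pnormB x y : pnorm (x - y) = pnorm (y - x).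
Proof. by rewrite -opprB pnormN. Qed.

Lemma pnorm_dom x y : vabs x <= y -> pnorm x <= pnorm y.
Proof.
move=> xy; apply: pnorm_solid; rewrite [vabs y]vger0_abs//.
exact: le_trans (vabs_ge0 x) xy.
Qed.

Lemma pnorm_abs x : pnorm (vabs x) = pnorm x.
Proof. by apply/le_anti; rewrite !pnorm_solid ?vabs_abs. Qed.

Lemma pnorm_ge0_le x y : 0 <= x -> x <= y -> pnorm x <= pnorm y.
Proof. by move=> x0 xy; apply: pnorm_dom; rewrite vger0_abs. Qed.

(** A p-norm satisfies the triangle inequality up to this factor. *)
Definition quasi_cst : R := 2 `^ p^-1.

Lemma quasi_cst_gt0 : 0 < quasi_cst. Proof. exact: powR_gt0. Qed.

Lemma pnormD_quasi x y : pnorm (x + y) <= quasi_cst * (pnorm x + pnorm y).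
Proof.
rewrite -[leRHS](powR_invK p0); last first.
  by rewrite mulr_ge0 ?addr_ge0 ?pnorm_ge0 ?powR_ge0.
apply: powR_le_inv; rewrite ?pnorm_ge0// (le_trans (pnormD _ _))//.
rewrite powRM ?powR_ge0 ?addr_ge0 ?pnorm_ge0// /quasi_cst powR_Vinv// mulr_natl mulr2n.
by rewrite lerD// powR_le ?pnorm_ge0 ?lerDl ?lerDr ?pnorm_ge0// ltW.
Qed.

(** Convergence is phrased with sequences and the p-norm, because the limits below
    are limits of explicit approximations. *)
Definition ncvg u l := forall e, 0 < e ->
  exists N, forall n, (N <= n)%N -> pnorm (u n - l) < e.

Definition ncauchy u := forall e, 0 < e ->
  exists N, forall m n, (N <= m)%N -> (N <= n)%N -> pnorm (u m - u n) < e.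

Lemma entourage_pnorm e : 0 < e ->
  entourage [set xy : X * X | pnorm (xy.1 - xy.2) < e].
Proof. by move=> e0; rewrite pnorm_entourageE; exists e. Qed.

Lemma entourage_pnormP (A : set (X * X)) : entourage A ->
  exists2 e, 0 < e & forall x y, pnorm (x - y) < e -> A (x, y).
Proof.
by rewrite pnorm_entourageE => -[e /= e0 eA]; exists e => // x y xy; exact: eA.
Qed.

Lemma nbhs_pnorm x e : 0 < e -> nbhs x [set y | pnorm (x - y) < e].
Proof.
move=> /entourage_pnorm /(nbhs_entourage x); apply: filterS => y.
by rewrite /xsection/= inE.
Qed.

Lemma nbhs_pnormP x (A : set X) : nbhs x A ->
  exists2 e, 0 < e & forall y, pnorm (x - y) < e -> A y.
Proof.
move=> /nbhsP[B /entourage_pnormP[e e0 eB] BA]; exists e => // y xy.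
by apply: BA; rewrite /xsection/= inE; exact: eB.
Qed.

Lemma ncauchy_cvg u : ncauchy u -> exists l, ncvg u l.
Proof.
move=> cu; have [] := @pnorm_complete _ _ X (u @ \oo).
- move=> A /entourage_pnormP[e e0 eA]; have [N hN] := cu e e0.
  exists ([set x | exists2 n, (N <= n)%N & x = u n], [set x | exists2 n, (N <= n)%N & x = u n]).
    by split; exists N => // n /= ?; exists n.
  by move=> [x y] /= [[m ? ->] [n ? ->]]; exact/eA/hN.
- move=> l ul; exists l => e e0.
  have [N _ hN] := ul _ (nbhs_pnorm l e0); exists N => n /hN /=.
  by rewrite pnormB.
Qed.

Lemma pnorm_lt_eq0 x : (forall e, 0 < e -> pnorm x < e) -> x = 0.
Proof.
move=> h; apply: pnorm_eq0; apply/eqP; rewrite eq_le pnorm_ge0 andbT.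
by apply/ler_addgt0Pl => e /h /ltW; rewrite addr0.
Qed.

Lemma pnormD_lt e : 0 < e ->
  exists2 d, 0 < d & forall x y, pnorm x < d -> pnorm y < d -> pnorm (x + y) < e.
Proof.
move=> e0; have Q0 := quasi_cst_gt0; exists (e / (2 * quasi_cst)).
  by rewrite divr_gt0// mulr_gt0.
move=> x y xd yd; apply: le_lt_trans (pnormD_quasi _ _) _; rewrite mulrC -ltr_pdivlMr//.
have -> : e / quasi_cst = e / (2 * quasi_cst) + e / (2 * quasi_cst).
  by field; rewrite gt_eqF.
by rewrite ltrD.
Qed.

Lemma ncvgD u v l k : ncvg u l -> ncvg v k -> ncvg (fun n => u n + v n) (l + k).
Proof.
move=> ul vk e /pnormD_lt[d d0 hd]; have [N hN] := ul d d0; have [M hM] := vk d d0.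
exists (maxn N M) => n; rewrite geq_max => /andP[/hN h1 /hM h2].
by rewrite opprD addrACA hd.
Qed.

Lemma ncvg_dom u v l k : (forall n, vabs (v n - k) <= vabs (u n - l)) ->
  ncvg u l -> ncvg v k.
Proof.
move=> h ul e /ul[N hN]; exists N => n /hN; apply: le_lt_trans.
exact: pnorm_solid.
Qed.

Lemma ncvgZ a u l : ncvg u l -> ncvg (fun n => a *: u n) (a *: l).
Proof.
move=> ul e e0; have [|N hN] := ul (e / (`|a| + 1)).
  by rewrite divr_gt0// ltr_wpDl.
exists N => n /hN; rewrite -scalerBr pnormZ ltr_pdivlMr ?ltr_wpDl//; apply: le_lt_trans.
by rewrite mulrC ler_wpM2l ?pnorm_ge0// lerDl.
Qed.

Lemma ncvg_cst l : ncvg (fun=> l) l.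
Proof. by move=> e e0; exists 0%N => n _; rewrite subrr pnorm0. Qed.

Lemma ncvgB u v l k : ncvg u l -> ncvg v k -> ncvg (fun n => u n - v n) (l - k).
Proof. by move=> ul /(ncvgZ (-1)) /(ncvgD ul); rewrite scaleN1r; under eq_fun do rewrite scaleN1r. Qed.

Lemma ncvg_unique u l k : ncvg u l -> ncvg u k -> l = k.
Proof.
move=> ul uk; apply/eqP; rewrite -subr_eq0; apply/eqP/pnorm_lt_eq0 => e e0.
have [N hN] := ncvgB ul uk e0; have := hN N (leqnn _).
by rewrite subrr sub0r pnormN.
Qed.

(** The negative part of the limit is dominated by the distance to any
    nonnegative element. *)
Lemma ncvg_ge0 u l : (forall n, 0 <= u n) -> ncvg u l -> 0 <= l.
Proof.
move=> u0 ul; have -> : l = vjoin l 0; last exact: vjoin_ler.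
apply/eqP; rewrite -subr_eq0; apply/eqP/pnorm_lt_eq0 => e /ul[N hN].
apply: le_lt_trans (hN N (leqnn _)); apply: pnorm_solid.
rewrite vabs_distC vger0_abs ?vsubr_ge0 ?vjoin_lel//.
rewrite vleBl; apply: vjoinP; rewrite -vleBl ?subrr ?vabs_ge0//.
by rewrite vleBl (le_trans (u0 N))// -vleBl vle_abs.
Qed.

Lemma ncvg_le u v l k : (forall n, u n <= v n) -> ncvg u l -> ncvg v k -> l <= k.
Proof.
move=> uv ul vk; rewrite -vsubr_ge0; apply: ncvg_ge0 (ncvgB vk ul) => n.
by rewrite vsubr_ge0.
Qed.

Lemma ncvg_join u v l k : ncvg u l -> ncvg v k ->
  ncvg (fun n => vjoin (u n) (v n)) (vjoin l k).
Proof.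
move=> ul vk.
have ul' : ncvg (fun n => vabs (u n - l)) 0.
  by move=> e /ul[N hN]; exists N => n /hN; rewrite subr0 pnorm_abs.
have vk' : ncvg (fun n => vabs (v n - k)) 0.
  by move=> e /vk[N hN]; exists N => n /hN; rewrite subr0 pnorm_abs.
apply: ncvg_dom (ncvgD ul' vk') => n; rewrite addr0 subr0.
by apply: le_trans (vabs_joinB _ _ _ _) _; exact: vle_abs.
Qed.

Lemma ncvg_abs u l : ncvg u l -> ncvg (fun n => vabs (u n)) (vabs l).
Proof.
move=> ul; have := ncvg_join ul (ncvgZ (-1) ul); rewrite scaleN1r.
by under eq_fun do rewrite scaleN1r.
Qed.

Lemma ncvg_pnorm_le u l s : (forall n, pnorm (u n) <= s) -> ncvg u l -> pnorm l <= s.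
Proof.
move=> us ul; have s0 : 0 <= s := le_trans (pnorm_ge0 _) (us 0%N).
have h e : 0 < e -> pnorm l `^ p <= s `^ p + e `^ p.
  move=> /ul[N hN]; rewrite -(subrK (u N) l) (le_trans (pnormD _ _))// addrC lerD//.
    by rewrite powR_le ?pnorm_ge0// ltW.
  by rewrite powR_le ?pnorm_ge0 ?ltW// pnormB hN.
apply: (powR_cancel_le p0); rewrite ?pnorm_ge0//; apply/ler_addgt0Pl => e e0.
by have := h (e `^ p^-1) (powR_gt0 _ e0); rewrite (powR_Vinv p0 (ltW e0)) addrC.
Qed.

(** The positive part of [x] has norm at most [e * pnorm y] for every [e]. *)
Lemma vle_archimedean x y : 0 <= y -> (forall e, 0 < e -> x <= e *: y) -> x <= 0.
Proof.
move=> y0 h; suff -> : x = x - vjoin x 0.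
  by rewrite -vleN oppr0 opprB vsubr_ge0 vjoin_lel.
rewrite -[LHS]subr0; congr (_ - _); apply/esym/pnorm_lt_eq0 => e e0.
have d0 : 0 < e / (pnorm y + 1) by rewrite divr_gt0// ltr_wpDl ?pnorm_ge0.
have := pnorm_ge0_le (vjoin_ler x 0) (vjoinP (h _ d0) (vscale_ge0 (ltW d0) y0)).
move=> /le_lt_trans; apply; rewrite pnormZ ger0_norm ?ltW// mulrAC.
rewrite ltr_pdivrMr ?ltr_wpDl ?pnorm_ge0// ltr_pM2l//.
by rewrite ltrDl.
Qed.

End PBanachTheory.

(** * Lattice-linear inequalities *)

Section FourierMotzkin.
Context (R : realType) (X : vectorLatticeType R).

Lemma exists_gt_all_lt (l : R) (hi : seq R) : all (fun h => l < h) hi ->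
  exists2 s, l < s & all (fun h => s < h) hi.
Proof.
elim: hi => [_|h hi IH /= /andP[lh /IH[s ls shi]]].
  by exists (l + 1); rewrite ?ltrDl.
exists (Num.min s ((l + h) / 2)); first by rewrite lt_min ls/=; lra.
apply/andP; split; first by rewrite gt_min; apply/orP; right; lra.
by apply: sub_all shi => k sk; rewrite gt_min sk.
Qed.

Lemma exists_between (lo hi : seq R) :
  (forall l h, l \in lo -> h \in hi -> l < h) ->
  exists2 s, (forall l, l \in lo -> l < s) & (forall h, h \in hi -> s < h).
Proof.
elim: lo => [_|l lo IH lohi].
  elim: hi => [|h hi [s _ shi]]; first by exists 0.
  exists (Num.min s (h - 1)) => // k; rewrite inE => /predU1P[->|/shi sk].
    by rewrite gt_min; apply/orP; right; lra.
  by rewrite gt_min sk.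
have [|s los shi] := IH; first by move=> ? ? h1 h2; rewrite lohi// inE h1 orbT.
have [|r lr /allP rhi] := @exists_gt_all_lt l hi.
  by apply/allP => h hh; rewrite lohi// mem_head.
exists (Num.max s r) => [k|h hh]; last by rewrite gt_max shi// rhi.
by rewrite inE lt_max => /predU1P[->|/los->//]; rewrite lr orbT.
Qed.

(** Elimination of one variable replaces the forms in which it occurs by the
    convex combinations of two of them that cancel it; convex combinations
    preserve upper bounds in any ordered vector space. *)
Lemma fourier_motzkin (I : choiceType) (r : seq I) (L : seq (I -> R))
    (x : I -> X) (y : X) : uniq r ->
  (forall t : I -> R, has (fun c => 0 <= \sum_(k <- r) c k * t k) L) ->
  all (fun c => \sum_(k <- r) c k *: x k <= y) L -> 0 <= y.
Proof.
elim: r L => [|i r IH] L /=.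
  move=> _ /(_ (fun=> 0)); case: L => // c L _ /=.
  by rewrite big_nil => /andP[].
move=> /andP[ir ur] hL /allP yL.
pose P := [seq c <- L | 0 < c i]; pose N := [seq c <- L | c i < 0].
pose Z := [seq c <- L | c i == 0].
pose comb (a b : I -> R) k := (- b i / (a i - b i)) * a k + (a i / (a i - b i)) * b k.
apply: (IH (Z ++ [seq comb a b | a <- P, b <- N])) => // [t|]; last first.
  apply/allP => c; rewrite mem_cat => /orP[|].
    rewrite mem_filter => /andP[/eqP ci cL].
    by have := yL _ cL; rewrite big_cons ci scale0r add0r.
  move=> /allpairsP[[a b] /= [+ + ->]].
  rewrite !mem_filter => /andP[ai aL] /andP[bi bL].
  have ab : 0 < a i - b i by lra.
  have -> : y = (- b i / (a i - b i)) *: y + (a i / (a i - b i)) *: y.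
    by rewrite -scalerDl -mulrDl addrC divff ?scale1r ?gt_eqF.
  have -> : \sum_(k <- r) comb a b k *: x k =
      (- b i / (a i - b i)) *: (\sum_(k <- i :: r) a k *: x k) +
      (a i / (a i - b i)) *: (\sum_(k <- i :: r) b k *: x k).
    rewrite !big_cons !scalerDr !scaler_sumr addrACA !scalerA -scalerDl.
    rewrite [X in X *: x i](_ : _ = 0) ?scale0r ?add0r; last first.
      by field; rewrite gt_eqF.
    rewrite -big_split/=; apply: eq_bigr => k _.
    by rewrite !scalerA -scalerDl.
  by apply: vleD; apply: vleZ; rewrite ?divr_ge0 ?yL//; lra.
apply/negPn/negP; rewrite -all_predC => /allP /= neg.
pose m (c : I -> R) := \sum_(k <- r) c k * t k.
have [l h|s los shi] := @exists_between [seq m b / (- b i) | b <- N] [seq - m a / a i | a <- P].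
  move=> /mapP[b bN ->] /mapP[a aP ->].
  have : ~~ (0 <= \sum_(k <- r) comb a b k * t k).
    by apply: neg; rewrite mem_cat; apply/orP; right; apply/allpairsP; exists (a, b).
  move: aP bN; rewrite !mem_filter => /andP[ai _] /andP[bi _]; rewrite -ltNge.
  have ab : 0 < a i - b i by lra.
  have -> : \sum_(k <- r) comb a b k * t k = (- b i * m a + a i * m b) / (a i - b i).
    rewrite /m mulrDl !mulr_sumr !mulr_suml -big_split/=; apply: eq_bigr => k _.
    by rewrite /comb; field; rewrite gt_eqF.
  rewrite pmulr_llt0 ?invr_gt0// => h0.
  by rewrite ltr_pdivrMr ?oppr_gt0// mulrAC ltr_pdivlMr//; lra.
have /hasP[c cL] := hL (fun k => if k == i then s else t k).
rewrite big_cons eqxx.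
have -> : \sum_(k <- r) c k * (if k == i then s else t k) = m c.
  apply: eq_big_seq => k kr; case: eqP => // ki.
  by move: ir; rewrite -ki kr.
apply/negP; rewrite -ltNge.
have [ci|ci|ci] := ltgtP (c i) 0.
- have : m c / - c i < s.
    by apply: los; apply: (map_f (fun b => m b / - b i)); rewrite mem_filter ci.
  by rewrite ltr_pdivrMr ?oppr_gt0//; lra.
- have : s < - m c / c i.
    by apply: shi; apply: (map_f (fun a => - m a / a i)); rewrite mem_filter ci.
  by rewrite ltr_pdivlMr//; lra.
- rewrite ci mul0r add0r ltNge neg// mem_cat mem_filter cL ci eqxx//.
Qed.

End FourierMotzkin.

Section LatticeTerms.
Context (R : realType) (X : vectorLatticeType R) (n : nat) (x : 'I_n -> X).
Local Notation rV := 'rV[R]_n.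
Implicit Types (f g : rV -> R) (y z : X).

(** A lattice-linear expression is recorded by its two evaluations, as a function
    on R^n and at the family [x]; this replaces a syntax of terms. *)
Inductive jterm : (rV -> R) -> X -> Prop :=
| jterm_lin (c : 'I_n -> R) :
    jterm (fun t => \sum_k c k * t ord0 k) (\sum_k c k *: x k)
| jterm_join f g y z : jterm f y -> jterm g z ->
    jterm (fun t => Num.max (f t) (g t)) (vjoin y z).

(** Finite meets of the previous ones; by distributivity these form a vector
    lattice. *)
Inductive mterm : (rV -> R) -> X -> Prop :=
| mterm_join f y : jterm f y -> mterm f y
| mterm_meet f g y z : mterm f y -> mterm g z ->
    mterm (fun t => Num.min (f t) (g t)) (vmeet y z).

(** A join of forms that is nonnegative on R^n leaves no point where all forms are
    negative, so elimination applies with the join as upper bound. *)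
Lemma jterm_ge0 f y : jterm f y -> (forall t, 0 <= f t) -> 0 <= y.
Proof.
move=> fy f0.
suff [L h1 h2] : exists2 L : seq ('I_n -> R),
    forall t, 0 <= f t -> has (fun c => 0 <= \sum_k c k * t ord0 k) L &
    forall z, y <= z -> all (fun c => \sum_k c k *: x k <= z) L.
  apply: (@fourier_motzkin _ _ _ (index_enum 'I_n) L x y); rewrite ?index_enum_uniq//.
    move=> t; have := h1 (\row_k t k) (f0 _); apply: sub_has => c.
    by under eq_bigr do rewrite mxE.
  exact: h2.
elim: fy {f0} => {f y} [c|f g y z _ [L h1 h2] _ [M h3 h4]].
  by exists [:: c] => [t /= ->|z /= ->].
exists (L ++ M) => [t|u].
  by rewrite has_cat le_max => /orP[/h1->|/h3->]; rewrite ?orbT.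
by rewrite all_cat vjoin_le => /andP[/h2-> /h4].
Qed.

(** A meet is nonnegative when each of its joins is. This is the reason why
    lattice-linear inequalities pass from the reals to all vector lattices. *)
Lemma mterm_ge0 f y : mterm f y -> (forall t, 0 <= f t) -> 0 <= y.
Proof.
elim => {f y} [f y fy|f g y z _ IH1 _ IH2] h; first exact: jterm_ge0 fy h.
by apply: vmeetP; [apply: IH1|apply: IH2] => t; have := h t; rewrite le_min => /andP[].
Qed.

Lemma mterm_eq f g y z : mterm f y -> f =1 g -> y = z -> mterm g z.
Proof. by move=> fy /funext <- <-. Qed.

Lemma jterm_eq f g y z : jterm f y -> f =1 g -> y = z -> jterm g z.
Proof. by move=> fy /funext <- <-. Qed.

Lemma jtermD f g y z : jterm f y -> jterm g z -> jterm (fun t => f t + g t) (y + z).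
Proof.
move=> fy; elim: fy g z => {f y} [c g z|f1 f2 y1 y2 _ IH1 _ IH2 g z gz]; last first.
  apply: (jterm_eq (jterm_join (IH1 _ _ gz) (IH2 _ _ gz))); last by rewrite vjoinDr.
  by move=> t /=; rewrite addr_maxl.
elim=> {g z} [d|g1 g2 z1 z2 _ IH1 _ IH2].
  apply: (jterm_eq (jterm_lin (fun k => c k + d k))) => [t|].
    by rewrite -big_split/=; under eq_bigr do rewrite mulrDl.
  by rewrite -big_split/=; under eq_bigr do rewrite scalerDl.
apply: (jterm_eq (jterm_join IH1 IH2)) => [t /=|]; first by rewrite addr_maxr.
by rewrite [in RHS]addrC vjoinDr ![in RHS](addrC _ (\sum__ _)).
Qed.

Lemma mtermD f g y z : mterm f y -> mterm g z -> mterm (fun t => f t + g t) (y + z).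
Proof.
move=> fy; elim: fy g z => {f y} [f y fy g z|f1 f2 y1 y2 _ IH1 _ IH2 g z gz]; last first.
  apply: (mterm_eq (mterm_meet (IH1 _ _ gz) (IH2 _ _ gz))); last by rewrite vmeetDr.
  by move=> t /=; rewrite addr_minl.
elim=> {g z} [g z gz|g1 g2 z1 z2 _ IH1 _ IH2].
  exact/mterm_join/jtermD.
apply: (mterm_eq (mterm_meet IH1 IH2)) => [t /=|]; first by rewrite addr_minr.
by rewrite [in RHS]addrC vmeetDr ![in RHS](addrC _ y).
Qed.

Lemma mterm_lin (c : 'I_n -> R) :
  mterm (fun t => \sum_k c k * t ord0 k) (\sum_k c k *: x k).
Proof. exact/mterm_join/jterm_lin. Qed.

Lemma mterm_vjoin f g y z : mterm f y -> mterm g z ->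
  mterm (fun t => Num.max (f t) (g t)) (vjoin y z).
Proof.
move=> fy; elim: fy g z => {f y} [f y fy g z|f1 f2 y1 y2 _ IH1 _ IH2 g z gz]; last first.
  apply: (mterm_eq (mterm_meet (IH1 _ _ gz) (IH2 _ _ gz))) => [t /=|].
    by rewrite max_minl.
  by rewrite -!(vjoinC z) -vjoin_meetr.
elim=> {g z} [g z gz|g1 g2 z1 z2 _ IH1 _ IH2].
  exact/mterm_join/jterm_join.
apply: (mterm_eq (mterm_meet IH1 IH2)) => [t /=|]; first by rewrite max_minr.
by rewrite vjoin_meetr.
Qed.

Lemma jtermN f y : jterm f y -> mterm (fun t => - f t) (- y).
Proof.
elim=> {f y} [c|f g y z _ IH1 _ IH2].
  apply: (mterm_eq (mterm_lin (fun k => - c k))) => [t|]; rewrite -sumrN.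
    by under eq_bigr do rewrite mulNr.
  by under eq_bigr do rewrite scaleNr.
apply: (mterm_eq (mterm_meet IH1 IH2)) => [t /=|]; first by rewrite oppr_max.
by rewrite vjoinN.
Qed.

Lemma mtermN f y : mterm f y -> mterm (fun t => - f t) (- y).
Proof.
elim=> {f y} [f y|f g y z _ IH1 _ IH2]; first exact: jtermN.
apply: (mterm_eq (mterm_vjoin IH1 IH2)) => [t /=|]; first by rewrite oppr_min.
by rewrite vmeetN.
Qed.

Lemma mtermZ_ge0 a f y : 0 <= a -> mterm f y -> mterm (fun t => a * f t) (a *: y).
Proof.
move=> a0; elim=> {f y} [f y fy|f g y z _ IH1 _ IH2]; last first.
  apply: (mterm_eq (mterm_meet IH1 IH2)) => [t /=|]; first by rewrite minr_pMr.
  by rewrite vmeetZ.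
apply/mterm_join; elim: fy => {f y} [c|f g y z _ IH1 _ IH2]; last first.
  apply: (jterm_eq (jterm_join IH1 IH2)) => [t /=|]; first by rewrite maxr_pMr.
  by rewrite vjoinZ.
apply: (jterm_eq (jterm_lin (fun k => a * c k))) => [t|].
  by rewrite mulr_sumr; under eq_bigr do rewrite -mulrA.
by rewrite scaler_sumr; under eq_bigr do rewrite -scalerA.
Qed.

Lemma mtermZ a f y : mterm f y -> mterm (fun t => a * f t) (a *: y).
Proof.
move=> fy; have [a0|a0] := leP 0 a; first exact: mtermZ_ge0.
have a0' : 0 <= - a by rewrite oppr_ge0 ltW.
apply: (mterm_eq (mtermN (mtermZ_ge0 a0' fy))) => [t|].
  by rewrite mulNr opprK.
by rewrite scaleNr opprK.
Qed.

Lemma mterm_abs f y : mterm f y -> mterm (fun t => `|f t|) (vabs y).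
Proof.
move=> fy; apply: (mterm_eq (mterm_vjoin fy (mtermN fy))) => // t.
by rewrite /= maxrN.
Qed.

Lemma mterm0 : mterm (fun=> 0) 0.
Proof.
apply: (mterm_eq (mterm_lin (fun=> 0))) => [t|]; apply: big1 => k _.
  by rewrite mul0r.
by rewrite scale0r.
Qed.

Lemma mterm_sum m (F : 'I_m -> rV -> R) (Y : 'I_m -> X) :
  (forall i, mterm (F i) (Y i)) -> mterm (fun t => \sum_i F i t) (\sum_i Y i).
Proof.
elim: m F Y => [|m IH] F Y FY.
  by apply: (mterm_eq mterm0) => [t|]; rewrite big_ord0.
have FY' := IH _ _ (fun i => FY (lift ord0 i)).
by apply: (mterm_eq (mtermD (FY ord0) FY')) => [t|]; rewrite big_ord_recl.
Qed.

Lemma mterm_coord k : mterm (fun t => t ord0 k) (x k).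
Proof.
apply: (mterm_eq (mterm_lin (fun i => (i == k)%:R))) => [t|];
  rewrite (bigD1 k)//= eqxx ?mul1r ?scale1r big1 ?addr0// => i /negbTE ->.
  by rewrite mul0r.
by rewrite scale0r.
Qed.

Definition l1 (t : rV) : R := \sum_k `|t ord0 k|.
Definition vl1 : X := \sum_k vabs (x k).

Lemma mterm_l1 : mterm l1 vl1.
Proof. by apply: mterm_sum => k; exact/mterm_abs/mterm_coord. Qed.

Lemma mterm_le f g y z : mterm f y -> mterm g z -> (forall t, f t <= g t) -> y <= z.
Proof.
move=> /mtermN fy gz fg; rewrite -vsubr_ge0; apply: (mterm_ge0 (mtermD gz fy)) => t.
by rewrite subr_ge0.
Qed.

Lemma mterm_dist e f g y z : mterm f y -> mterm g z ->
  (forall t, `|f t - g t| <= e * l1 t) -> vabs (y - z) <= e *: vl1.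
Proof.
move=> fy gz; apply: mterm_le; last exact/mtermZ/mterm_l1.
exact/mterm_abs/(mtermD fy)/mtermN.
Qed.

Lemma mterm_homog f y (a : R) t : mterm f y -> 0 <= a -> f (a *: t) = a * f t.
Proof.
move=> + a0; elim=> {f y} [f y|f g y z _ IH1 _ IH2]; last first.
  by rewrite IH1 IH2 minr_pMr.
elim=> {f y} [c|f g y z _ IH1 _ IH2]; last by rewrite IH1 IH2 maxr_pMr.
by rewrite mulr_sumr; apply: eq_bigr => k _; rewrite mxE mulrCA.
Qed.

End LatticeTerms.

(** * Approximation of positively homogeneous functions *)

Section PosHomogCont.
Context (R : realType) (n : nat).
Implicit Types g h : 'rV[R]_n -> R.

Lemma phc_coord k : pos_homog_cont (fun t : 'rV[R]_n => t ord0 k).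
Proof. by split=> [t|a t _]; [exact: coord_continuous|rewrite mxE]. Qed.

Lemma phc_lin (a : R) g h : pos_homog_cont g -> pos_homog_cont h ->
  pos_homog_cont (fun t => a * g t + h t).
Proof.
move=> [gc gh] [hc hh]; split=> [t|b t b0].
  exact: (cvgD (cvgMl_tmp (gc t)) (hc t)).
by rewrite gh// hh// mulrDr mulrCA.
Qed.

Lemma phc_abs g : pos_homog_cont g -> pos_homog_cont (fun t => `|g t|).
Proof.
move=> [gc gh]; split=> [t|b t b0]; first exact: (cvg_norm (gc t)).
by rewrite gh// normrM ger0_norm.
Qed.

Lemma phc_eq g h : g =1 h -> pos_homog_cont g -> pos_homog_cont h.
Proof. by move/funext => ->. Qed.

Lemma phc0 : pos_homog_cont (fun _ : 'rV[R]_n => 0 : R).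
Proof. by split=> [t|b t b0]; [exact: cst_continuous|rewrite mulr0]. Qed.

Lemma phcZ (a : R) g : pos_homog_cont g -> pos_homog_cont (fun t => a * g t).
Proof. by move=> pg; apply: phc_eq (phc_lin a pg phc0) => t; rewrite addr0. Qed.

Lemma phcD g h : pos_homog_cont g -> pos_homog_cont h -> pos_homog_cont (fun t => g t + h t).
Proof. by move=> pg ph; apply: phc_eq (phc_lin 1 pg ph) => t; rewrite mul1r. Qed.

Lemma phc_max g h : pos_homog_cont g -> pos_homog_cont h ->
  pos_homog_cont (fun t => Num.max (g t) (h t)).
Proof.
move=> pg ph.
apply: phc_eq (phcZ 2^-1 (phcD (phcD pg ph) (phc_abs (phc_lin (-1) ph pg)))) => t.
by rewrite maxr_absE mulN1r [- h t + _]addrC mulrC.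
Qed.

Lemma phc_min g h : pos_homog_cont g -> pos_homog_cont h ->
  pos_homog_cont (fun t => Num.min (g t) (h t)).
Proof.
move=> /(phcZ (-1)) pg /(phcZ (-1)) ph; apply: phc_eq (phcZ (-1) (phc_max pg ph)) => t.
by rewrite !mulN1r oppr_max !opprK.
Qed.

Lemma phc_sum (I : Type) (r : seq I) (F : I -> 'rV[R]_n -> R) :
  (forall i, pos_homog_cont (F i)) -> pos_homog_cont (fun t => \sum_(i <- r) F i t).
Proof.
move=> pF; elim: r => [|i r IH].
  by apply: phc_eq phc0 => t; rewrite big_nil.
by apply: phc_eq (phcD (pF i) IH) => t; rewrite big_cons.
Qed.

Lemma mterm_phc (X : vectorLatticeType R) (x : 'I_n -> X) f y :
  mterm x f y -> pos_homog_cont f.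
Proof.
elim=> {f y} [f y|f g y z _ IH1 _ IH2]; last exact: phc_min.
elim=> {f y} [c|f g y z _ IH1 _ IH2]; last exact: phc_max.
by apply: phc_sum => k; exact/phcZ/phc_coord.
Qed.

Lemma phc_l1 : pos_homog_cont (@l1 R n).
Proof. by apply: phc_sum => k; exact/phc_abs/phc_coord. Qed.

Lemma l1_ge0 (t : 'rV[R]_n) : 0 <= l1 t. Proof. exact: sumr_ge0. Qed.

Lemma ler_coord_l1 (t : 'rV[R]_n) k : `|t ord0 k| <= l1 t.
Proof. by rewrite /l1 (bigD1 k)//= lerDl sumr_ge0. Qed.

Lemma l1_eq0 (t : 'rV[R]_n) : l1 t = 0 -> t = 0.
Proof.
move=> t0; apply/rowP => k; rewrite mxE; apply/normr0_eq0/le_anti.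
by rewrite normr_ge0 -t0 ler_coord_l1.
Qed.

Lemma compact_l1_sphere : compact [set t : 'rV[R]_n | l1 t = 1].
Proof.
apply: (@subclosed_compact _ _ [set v : 'rV[R]_n | forall i, v ord0 i \in `[(-1), 1]]).
- apply: (@closed_comp _ _ (@l1 R n) [set 1]); last exact: closed_eq.
  by move=> t _; exact: phc_l1.1.
- have := @rV_compact _ n (fun=> `[(-1), 1 : R]%classic).
  by apply=> _; exact: segment_compact.
- by move=> t /= t1 i; rewrite in_itv/= -ler_norml -t1 ler_coord_l1.
Qed.

Lemma phc_bounded h : pos_homog_cont h ->
  exists2 M, 0 < M & forall t, l1 t = 1 -> `|h t| <= M.
Proof.
move=> [hc _]; have : compact (h @` [set t : 'rV[R]_n | l1 t = 1]).
  apply: continuous_compact compact_l1_sphere.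
  exact: continuous_subspaceT.
move=> /compact_bounded[M [Mr hM]]; exists (`|M| + 1); first by rewrite ltr_wpDl.
move=> t t1; apply: hM; last by exists t.
by rewrite (le_lt_trans (ler_norm M))// ltrDl.
Qed.

(** The cones [h s * l1 t + L * l1 (t - l1 t *: s)] are lattice-linear; for a
    large slope they lie above [h] up to [e], and they touch [h] at [s]. *)
Lemma cone_above h (e : R) s : pos_homog_cont h -> 0 < e -> l1 s = 1 ->
  exists L : R, forall t, l1 t = 1 ->
    h t - e <= h s + L * \sum_k `|t ord0 k - s ord0 k|.
Proof.
move=> ph e0 s1; have [M M0 hM] := phc_bounded ph.
have := ph.1 s; move=> /cvgrPdist_lt/(_ e e0)/nbhs_ballP[d/= d0 hd].
(* Beyond the distance [d], the slope alone exceeds the oscillation [2 * M]. *)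
exists (2 * M / d) => t t1.
have [td|td] := ltP (\sum_k `|t ord0 k - s ord0 k|) d.
  have : `|h s - h t| < e.
    apply: hd; split => // i j; rewrite ord1 /ball/= distrC.
    by apply: le_lt_trans td; rewrite (bigD1 j)//= lerDl sumr_ge0.
  have : 0 <= 2 * M / d * \sum_k `|t ord0 k - s ord0 k|.
    by rewrite mulr_ge0 ?sumr_ge0// divr_ge0 ?mulr_ge0// ltW.
  by rewrite ltr_norml => ? /andP[? ?]; lra.
have : 2 * M <= 2 * M / d * \sum_k `|t ord0 k - s ord0 k|.
  by rewrite mulrAC ler_pdivlMr// ler_pM2l// mulr_gt0.
have := hM _ t1; have := hM _ s1; rewrite !ler_norml => /andP[? ?] /andP[? ?].
by lra.
Qed.

(** By compactness of the sphere, the minimum of finitely many of these cones is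
    uniformly close to [h] there; homogeneity does the rest. *)
Lemma mterm_dense (X : vectorLatticeType R) (x : 'I_n -> X) h (e : R) :
  pos_homog_cont h -> 0 < e ->
  exists f y, mterm x f y /\ forall t, `|f t - h t| <= e * l1 t.
Proof.
move=> ph e0.
suff [f [y [fy hf]]] : exists f y, mterm x f y /\
    forall t, l1 t = 1 -> `|f t - h t| <= e.
  exists f, y; split=> // t; have := l1_ge0 t; rewrite le_eqVlt => /predU1P[t0|t0].
    have -> : t = 0 *: t by rewrite scale0r; exact/l1_eq0.
    by rewrite (mterm_homog t fy)// ph.2// !mul0r subrr normr0 mulr_ge0 ?l1_ge0// ltW.
  have [u tE u1] : exists2 u, t = l1 t *: u & l1 u = 1.
    exists ((l1 t)^-1 *: t); first by rewrite scalerA divff ?scale1r ?gt_eqF.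
    by rewrite phc_l1.2 ?invr_ge0 ?l1_ge0// mulVf ?gt_eqF.
  rewrite [in f t]tE [in h t]tE (mterm_homog u fy) ?ph.2 ?l1_ge0//.
  by rewrite -mulrBr normrM ger0_norm ?l1_ge0// [leRHS]mulrC ler_pM2l// hf.
have [M M0 hM] := phc_bounded ph.
have hsl (s : 'rV[R]_n) : exists L : R, l1 s = 1 -> forall t, l1 t = 1 ->
    h t - e <= h s + L * \sum_k `|t ord0 k - s ord0 k|.
  have [/(cone_above ph e0)[L hL]|s1] := pselect (l1 s = 1); first by exists L.
  by exists 0.
have {hsl}[L hL] := choice hsl.
pose g s t := h s * l1 t + L s * \sum_k `|t ord0 k - l1 t * s ord0 k|.
have gterm s : exists y, mterm x (g s) y.
  pose F k (t : 'rV[R]_n) := `|t ord0 k + - (s ord0 k * l1 t)|.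
  have FY k : mterm x (F k) (vabs (x k + - (s ord0 k *: vl1 x))).
    exact/mterm_abs/(mtermD (mterm_coord _ _))/mtermN/mtermZ/mterm_l1.
  have := mtermD (mtermZ (h s) (mterm_l1 x)) (mtermZ (L s) (mterm_sum FY)).
  move=> gY; eexists; apply: (mterm_eq gY) => // t; rewrite /g.
  by under [X in _ = _ + _ * X]eq_bigr do rewrite [l1 t * _]mulrC.
have g1 s t : l1 t = 1 -> g s t = h s + L s * \sum_k `|t ord0 k - s ord0 k|.
  by move=> t1; rewrite /g t1 mulr1; under eq_bigr do rewrite mul1r.
have := compact_l1_sphere; rewrite compact_cover.
move=> /(_ _ [set s | l1 s = 1] (fun s => [set t | g s t < h t + e])).
case=> [s _|t /= t1|D Dsub hD].
- have [y /mterm_phc pg] := gterm s.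
  have -> : [set t | g s t < h t + e] = (fun t => g s t - h t) @^-1` [set r | r < e].
    by apply/seteqP; split=> t /=; rewrite ltrBlDl.
  apply: open_comp; last exact: open_lt.
  by move=> t _; exact: (cvgB (pg.1 t) (ph.1 t)).
- exists t => //=; rewrite g1// big1 ?mulr0 ?addr0 ?ltrDl// => k _.
  by rewrite subrr normr0.
have hr (r : seq 'rV[R]_n) : {subset r <= [set s | l1 s = 1]} ->
  exists f y, [/\ mterm x f y, forall t, l1 t = 1 -> h t - e <= f t &
    forall s t, s \in r -> f t <= g s t].
  elim: r => [_|s r IH sr].
    exists (fun t => M * l1 t), (M *: vl1 x); split=> //.
      exact/mtermZ/mterm_l1.
    by move=> t t1; rewrite t1 mulr1; have := hM t t1; rewrite ler_norml; lra.
  have [|f [y [fy f1 f2]]] := IH; first by move=> u ur; apply: sr; rewrite inE ur orbT.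
  have [z gz] := gterm s.
  exists (fun t => Num.min (f t) (g s t)), (vmeet y z); split.
  - exact: mterm_meet.
  - move=> t t1; rewrite le_min f1//= g1// hL//.
    by have := sr s; rewrite mem_head inE; apply.
  - move=> u t; rewrite inE ge_min => /predU1P[->|/f2 ->//].
    by rewrite lexx orbT.
have [|f [y [fy f1 f2]]] := hr (finmap.enum_fset D).
  by move=> s sD; exact: Dsub.
exists f, y; split=> // t t1; have [s /= sD gs] := hD t t1.
have := f2 s t sD; have := f1 t t1; rewrite ler_norml.
lra.
Qed.

End PosHomogCont.

(** * Functional calculus in p-Banach lattices *)

Section Krivine.
Context (R : realType) (p : R) (hp : 0 < p <= 1) (X : pBanachLatticeType p).

Section Represents.
Context (n : nat) (x : 'I_n -> X).
Implicit Types (g h : 'rV[R]_n -> R) (y z : X).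

(** [y] is the value of [h] at [x] under a functional calculus, described without
    the calculus: the lattice-linear expressions whose functions tend to [h]
    uniformly on the sphere have values that tend to [y] relatively uniformly. *)
Definition represents h y := forall e : R, 0 < e -> exists f z,
  [/\ mterm x f z, forall t, `|f t - h t| <= e * l1 t & vabs (y - z) <= e *: vl1 x].

Lemma vl1_ge0 : 0 <= vl1 x. Proof. by apply: vsum_ge0 => k; exact: vabs_ge0. Qed.

Lemma mterm_represents f y : mterm x f y -> represents f y.
Proof.
move=> fy e e0; exists f, y; split=> // [t|].
  by rewrite subrr normr0 mulr_ge0 ?l1_ge0// ltW.
by rewrite subrr vabs0 vscale_ge0 ?vl1_ge0// ltW.
Qed.

(** The approximants satisfy the inequality up to a multiple of [vl1 x] by
    [mterm_le]; the Archimedean property removes the error. *)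
Lemma represents_le g h y z : represents g y -> represents h z ->
  (forall t, g t <= h t) -> y <= z.
Proof.
move=> gy hz gh; rewrite -vsubr_ge0 -vleN oppr0 opprB.
apply: (vle_archimedean vl1_ge0) => e e0.
have d0 : 0 < e / 4 by lra.
have [f [u [fu fg yu]]] := gy _ d0; have [k [v [kv kh zv]]] := hz _ d0.
have uv : u - v <= (e / 4 + e / 4) *: vl1 x.
  rewrite vleBl; apply: (mterm_le fu (mtermD (mtermZ (e / 4 + e / 4) (mterm_l1 x)) kv)).
  move=> t; have := fg t; have := kh t; have := gh t; rewrite !ler_norml mulrDl.
  by move=> ? /andP[? ?] /andP[? ?]; lra.
have -> : y - z = (y - u) + (u - v) + (v - z) by rewrite -!addrA !addKr.
have -> : e = e / 4 + (e / 4 + e / 4) + e / 4 by lra.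
rewrite ![in leRHS]scalerDl vleD//; last first.
  by rewrite (le_trans (vle_abs _))// vabs_distC.
by rewrite -scalerDl vleD// (le_trans (vle_abs _)).
Qed.

Lemma represents_unique h y z : represents h y -> represents h z -> y = z.
Proof. by move=> hy hz; apply/le_anti; rewrite (represents_le hy hz)// (represents_le hz hy). Qed.

(** Approximants of [h] have values that differ by small multiples of [vl1 x], so
    these values form a Cauchy sequence. *)
Lemma represents_exists h : pos_homog_cont h -> exists y, represents h y.
Proof.
move=> ph; pose d m : R := m.+1%:R^-1.
have d0 m : 0 < d m by rewrite invr_gt0.
have dle m k : (m <= k)%N -> d k <= d m by move=> mk; rewrite lef_pV2 ?posrE// ler_nat.
have hF m : exists fz : ('rV[R]_n -> R) * X, mterm x fz.1 fz.2 /\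
    forall t, `|fz.1 t - h t| <= d m * l1 t.
  by have [f [z H]] := mterm_dense x ph (d0 m); exists (f, z).
have {hF}[F hF] := choice hF; pose z m := (F m).2.
have zz m k : vabs (z m - z k) <= (d m + d k) *: vl1 x.
  have [h1 h2] := hF m; have [h3 h4] := hF k; apply: mterm_dist h1 h3 _ => t.
  rewrite mulrDl -(subrKA (h t)) (le_trans (ler_normD _ _))// lerD//.
  by rewrite distrC.
have pz m k : pnorm (z m - z k) <= (d m + d k) * pnorm (vl1 x).
  apply: le_trans (pnorm_dom (zz m k)) _.
  by rewrite pnormZ ger0_norm// addr_ge0 ?ltW.
have small (e : R) : 0 < e -> exists N, forall m, (N <= m)%N -> d m < e.
  move=> e0; have [N _ hN] := near_infty_natSinv_lt (PosNum e0).
  by exists N => m /hN.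
have [y zy] : exists y, ncvg z y.
  apply: ncauchy_cvg => e e0.
  have [|N hN] := small (e / (2 * (pnorm (vl1 x) + 1))).
    by rewrite divr_gt0// mulr_gt0// ltr_wpDl ?pnorm_ge0.
  exists N => m k /hN hm /hN hk; apply: le_lt_trans (pz m k) _.
  have : d m + d k < e / (pnorm (vl1 x) + 1).
    by move: hm hk; rewrite invfM mulrCA; lra.
  rewrite ltr_pdivlMr ?ltr_wpDl ?pnorm_ge0//; apply: le_lt_trans.
  by rewrite ler_pM2l ?addr_gt0// lerDl.
exists y => e e0; have [|N hN] := small (e / 2); first by lra.
have [h1 h2] := hF N; exists (F N).1, (z N); split=> // [t|].
  apply: le_trans (h2 t) _; rewrite ler_wpM2r ?l1_ge0//.
  by have := hN N (leqnn _); lra.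
have zyN : ncvg (fun k => z (k + N)%N) y.
  by move=> c /zy[M hM]; exists M => k Mk; apply: hM; exact: leq_trans (leq_addr _ _).
have := ncvg_le hp _ (ncvg_abs hp (ncvgB hp zyN (ncvg_cst (z N)))) (ncvg_cst (e *: vl1 x)).
apply => k; apply: le_trans (zz _ _) _.
rewrite -vsubr_ge0 -scalerBl vscale_ge0 ?vl1_ge0//.
by have := hN N (leqnn _); have := dle N (k + N)%N (leq_addl _ _); lra.
Qed.

Lemma represents_lin (a : R) g h y z : represents g y -> represents h z ->
  represents (fun t => a * g t + h t) (a *: y + z).
Proof.
move=> gy hz e e0; have a0 : 0 < `|a| + 1 by rewrite ltr_wpDl.
have d0 : 0 < e / (`|a| + 1) by rewrite divr_gt0.
have [f [u [fu fg yu]]] := gy _ d0; have [k [v [kv kh zv]]] := hz _ d0.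
have eE : e = `|a| * (e / (`|a| + 1)) + e / (`|a| + 1) by field; rewrite gt_eqF.
exists (fun t => a * f t + k t), (a *: u + v); split.
- exact/mtermD/kv/mtermZ.
- move=> t; rewrite opprD addrACA -mulrBr (le_trans (ler_normD _ _))//.
  by rewrite [in leRHS]eE mulrDl lerD// normrM -mulrA ler_wpM2l.
- rewrite opprD addrACA -scalerBr (le_trans (vabsD _ _))//.
  by rewrite [in leRHS]eE scalerDl vleD// vabsZ -scalerA vleZ.
Qed.

Lemma represents_max g h y z : represents g y -> represents h z ->
  represents (fun t => Num.max (g t) (h t)) (vjoin y z).
Proof.
move=> gy hz e e0; have d0 : 0 < e / 2 by lra.
have [f [u [fu fg yu]]] := gy _ d0; have [k [v [kv kh zv]]] := hz _ d0.
exists (fun t => Num.max (f t) (k t)), (vjoin u v); split.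
- exact: mterm_vjoin.
- move=> t; have := fg t; have := kh t; rewrite [in e * _](splitr e) mulrDl !ler_norml.
  move: (e / 2 * l1 t) => c /andP[? ?] /andP[? ?].
  by case: (leP (f t) (k t)) => ?; case: (leP (g t) (h t)) => ?; apply/andP; split; lra.
- apply: le_trans (vabs_joinB _ _ _ _) _.
  by rewrite [in leRHS](splitr e) scalerDl vleD.
Qed.

Lemma represents_min g h y z : represents g y -> represents h z ->
  represents (fun t => Num.min (g t) (h t)) (vmeet y z).
Proof.
move=> gy hz.
have r0 := mterm_represents (mterm0 x).
have rN g' y' : represents g' y' -> represents (fun t => - g' t) (- y').
  move=> /(represents_lin (-1))/(_ r0); rewrite scaleN1r addr0.
  by under eq_fun do rewrite mulN1r addr0.
have := rN _ _ (represents_max (rN _ _ gy) (rN _ _ hz)); rewrite -vmeetE.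
by under eq_fun do rewrite oppr_max !opprK.
Qed.

(** A calculus is monotone because it preserves joins, and it is determined on
    lattice-linear functions; density then determines it everywhere. *)
Lemma represents_krivine_calculus Phi h : krivine_calculus x Phi ->
  pos_homog_cont h -> represents h (Phi h).
Proof.
move=> [Phix Phih] ph.
have Phi_le g g' : pos_homog_cont g -> pos_homog_cont g' ->
    (forall t, g t <= g' t) -> Phi g <= Phi g'.
  move=> pg pg' gg'; have [_ + _] := Phih g g' pg pg'.
  have -> : (fun t => Num.max (g t) (g' t)) = g'.
    by apply/funext => t; rewrite max_r.
  by move=> ->; exact: vjoin_lel.
have Phi0 : Phi (fun=> 0) = 0.
  have [/(_ (-1)) + _ _] := Phih _ _ (@phc0 R n) (@phc0 R n).
  under eq_fun do rewrite mulr0 addr0.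
  by rewrite scaleN1r addNr.
have PhiD a g g' : pos_homog_cont g -> pos_homog_cont g' ->
    Phi (fun t => a * g t + g' t) = a *: Phi g + Phi g'.
  by move=> pg pg'; have [-> _ _] := Phih g g' pg pg'.
have Phim f z : mterm x f z -> Phi f = z.
  elim=> {f z} [f z|f g y z fy IH1 gz IH2]; last first.
    by have [_ _ ->] := Phih _ _ (mterm_phc fy) (mterm_phc gz); rewrite IH1 IH2.
  elim=> {f z} [c|f g y z fy IH1 gz IH2]; last first.
    have [_ -> _] := Phih _ _ (mterm_phc (mterm_join fy)) (mterm_phc (mterm_join gz)).
    by rewrite IH1 IH2.
  elim: (index_enum 'I_n) => [|k r IH].
    by rewrite big_nil -[RHS]Phi0; congr Phi; apply/funext => t; rewrite big_nil.
  rewrite big_cons -IH -(Phix k) -PhiD; last 2 first.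
    exact: phc_coord.
    by apply: phc_sum => i; exact/phcZ/phc_coord.
  by congr Phi; apply/funext => t; rewrite big_cons.
move=> e e0; have [f [z [fz fh]]] := mterm_dense x ph e0.
exists f, z; split=> //.
have el : pos_homog_cont (fun t => e * l1 t + f t).
  exact/phc_lin/(mterm_phc fz)/phc_l1.
have el' : pos_homog_cont (fun t => e * l1 t + h t) by exact/phc_lin/ph/phc_l1.
have pf := mterm_phc fz; have pl := @phc_l1 R n.
rewrite -(Phim _ _ fz) -(Phim _ _ (mterm_l1 x)) vabs_le opprB !vleBl.
rewrite -!PhiD//; apply/andP; split; apply: Phi_le => // t;
  by have := fh t; rewrite ler_norml => /andP[? ?]; lra.
Qed.

(** The relation [represents] is functional and total, and it is compatible with
    the operations; hence it is a calculus, so that the choice made by [krivine]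
    is a choice among calculi. *)
Lemma krivine_represents h : pos_homog_cont h -> represents h (krivine x h).
Proof.
move=> ph.
have ex g : exists y, pos_homog_cont g -> represents g y.
  have [/represents_exists[y gy]|ng] := pselect (pos_homog_cont g).
    by exists y.
  by exists 0.
have [Phi hPhi] := choice ex.
have cPhi : krivine_calculus x Phi.
  split=> [k|g k pg pk].
    apply: represents_unique (hPhi _ (phc_coord _ k)) _.
    exact/mterm_represents/mterm_coord.
  split=> [a||].
  - exact: represents_unique (hPhi _ (phc_lin a pg pk)) (represents_lin a (hPhi _ pg) (hPhi _ pk)).
  - exact: represents_unique (hPhi _ (phc_max pg pk)) (represents_max (hPhi _ pg) (hPhi _ pk)).
  - exact: represents_unique (hPhi _ (phc_min pg pk)) (represents_min (hPhi _ pg) (hPhi _ pk)).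
rewrite /krivine; case: xgetP => [y _ [Psi cPsi ->]|/(_ (Phi h))].
  exact: represents_krivine_calculus.
by case; exists Phi.
Qed.

End Represents.

(** An expression in linear combinations of [x] is an expression in [x]; the
    error bounds change by the sum of the entries of the matrix. *)
Lemma represents_comp m n (x : 'I_n -> X) (A : 'I_m -> 'I_n -> R) h y :
  represents (fun j => \sum_k A j k *: x k) h y ->
  represents x (fun t => h (\row_j \sum_k A j k * t ord0 k)) y.
Proof.
set Ax := fun j => _; pose At (t : 'rV[R]_n) := \row_j \sum_k A j k * t ord0 k.
move=> hy e e0.
pose La := \sum_j \sum_k `|A j k|.
have La0 : 0 <= La by rewrite sumr_ge0// => j _; exact: sumr_ge0.
have d0 : 0 < e / (La + 1) by rewrite divr_gt0// ltr_wpDl.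
have [f [z [fz fh yz]]] := hy _ d0.
have de (c : R) : 0 <= c -> e / (La + 1) * (La * c) <= e * c.
  move=> c0; rewrite mulrA ler_wpM2r// mulrAC ler_pdivrMr ?ltr_wpDl//.
  by rewrite ler_pM2l// lerDl.
exists (fun t => f (At t)), z; split.
- elim: fz => {f z fh yz} [f z|f g u v _ IH1 _ IH2]; last exact: mterm_meet.
  elim=> {f z} [c|f g u v _ IH1 _ IH2]; last exact: mterm_vjoin.
  apply: (mterm_eq (mterm_sum (fun j => mtermZ (c j) (mterm_lin x (A j))))) => // t.
  by apply: eq_bigr => j _; rewrite mxE.
- move=> t; apply: le_trans (fh _) _; apply: le_trans (de _ (l1_ge0 t)).
  rewrite ler_pM2l// /La mulr_suml; apply: ler_sum => j _; rewrite mxE.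
  rewrite (le_trans (ler_norm_sum _ _ _))// mulr_suml; apply: ler_sum => k _.
  by rewrite normrM ler_wpM2l// ler_coord_l1.
- apply: le_trans yz _.
  apply: (@le_trans _ _ ((e / (La + 1)) *: (La *: vl1 x))); last first.
    by rewrite scalerA -vsubr_ge0 -scalerBl vscale_ge0 ?vl1_ge0// subr_ge0; have := de 1 ler01; rewrite !mulr1.
  apply: vleZ; first exact: ltW.
  rewrite /La scaler_suml; apply: vle_sum => j.
  apply: le_trans (vabs_sum _ _) _; rewrite scaler_suml; apply: vle_sum => k.
  rewrite vabsZ; apply: vleZ => //.
  rewrite /vl1 (bigD1 k)//= -[X in X <= _]addr0 vleD2l.
  by apply: (big_ind (fun z : X => 0 <= z)) => // *; rewrite ?vabs_ge0 ?vaddr_ge0.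
Qed.

Lemma continuous_norm_powR (r : R) : 0 < r -> continuous (fun a : R => `|a| `^ r).
Proof.
move=> r0 a; have [->|a0] := eqVneq a 0.
  apply/cvgrPdist_lt => e e0; have d0 : 0 < e `^ r^-1 by exact: powR_gt0.
  apply/nbhs_ballP; exists (e `^ r^-1) => //= b; rewrite /ball/= sub0r normrN => bd.
  rewrite normr0 powR0 ?gt_eqF// sub0r normrN ger0_norm ?powR_ge0//.
  by rewrite -(powR_Vinv r0 (ltW e0)) gt0_ltr_powR ?nnegrE// ltW.
have a0' : `|a| \in `]0, +oo[ by rewrite in_itv/= andbT normr_gt0.
have : {for `|a|, continuous (@powR R ^~ r)}.
  apply: differentiable_continuous; apply/derivable1_diffP.
  exact: (@derivable_powR R 1 r _ a0').
exact: (cvg_comp _ _ (@norm_continuous _ R^o a)).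
Qed.

Lemma phc_lp (q : R) n : 0 < q -> pos_homog_cont (@lp_fun R q n).
Proof.
move=> q0; have qi0 : 0 < q^-1 by rewrite invr_gt0.
have sum0 (t : 'rV[R]_n) : 0 <= \sum_k `|t ord0 k| `^ q.
  by apply: sumr_ge0 => k _; exact: powR_ge0.
split=> [t|a t a0]; last first.
  rewrite /lp_fun -[in RHS](powR_invK q0 a0) -powRM ?powR_ge0// mulr_sumr.
  congr (_ `^ _); apply: eq_bigr => k _.
  by rewrite mxE normrM ger0_norm// powRM.
have -> : @lp_fun R q n = fun t => `|\sum_k `|t ord0 k| `^ q| `^ q^-1.
  by apply/funext => u; rewrite ger0_norm.
apply: (@continuous_comp _ _ _ _ (fun a : R => `|a| `^ q^-1)); last exact: continuous_norm_powR.
elim: (index_enum 'I_n) => [|k r IH].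
  rewrite (_ : (fun _ => _) = fun=> 0); first exact: cst_continuous.
  by apply/funext => u; rewrite big_nil.
rewrite (_ : (fun _ => _) = fun u : 'rV[R]_n =>
    `|u ord0 k| `^ q + \sum_(i <- r) `|u ord0 i| `^ q); last first.
  by apply/funext => u; rewrite big_cons.
apply: cvgD IH.
apply: (@continuous_comp _ _ _ (fun t : 'rV[R]_n => t ord0 k) (fun a : R => `|a| `^ q)).
  exact: coord_continuous.
exact: continuous_norm_powR.
Qed.

(** Both sides are values at [x] of positively homogeneous functions, the right one
    by composition with the matrix [A], so the scalar inequality suffices. *)
Lemma vl1_le_krivine m n (x : 'I_n -> X) (A : 'I_m -> 'I_n -> R) (c : R) :
  (forall a : 'I_n -> R, \sum_k `|a k| <=
     c * (\sum_j `|\sum_k A j k * a k| `^ p) `^ p^-1) ->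
  \sum_k vabs (x k) <= c *: krivine (fun j => \sum_k A j k *: x k) (@lp_fun R p m).
Proof.
move=> hA; have /andP[p0 _] := hp.
have := krivine_represents (fun j => \sum_k A j k *: x k) (@phc_lp p m p0).
move=> /represents_comp rep.
have := represents_lin c rep (mterm_represents (mterm0 x)); rewrite addr0.
move=> /(represents_le (mterm_represents (mterm_l1 x))); apply => t.
rewrite addr0 (le_trans (hA _))// /lp_fun.
by under [X in _ <= c * X `^ _]eq_bigr do rewrite mxE.
Qed.

End Krivine.

(** * A small-ball estimate *)

Section SmallBall.
Context (R : realType).
Implicit Types (s t d h c y e : R).

(** Half the odd antiderivative of |t|^(-1/2); its increments replace integrals. *)
Definition ssqrt t : R := if 0 <= t then Num.sqrt t else - Num.sqrt (- t).

Lemma ssqrtN t : ssqrt (- t) = - ssqrt t.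
Proof.
rewrite /ssqrt oppr_ge0 opprK; have [t0|t0|->] := ltgtP t 0.
- by rewrite opprK.
- by [].
- by rewrite !(oppr0, sqrtr0).
Qed.

Lemma ssqrt_incr t h : 0 < h ->
  h / Num.sqrt (`|t| + h) <= ssqrt (t + h) - ssqrt (t - h).
Proof.
move=> h0; wlog t0 : t / 0 <= t => [H|].
  have [t0|t0] := leP 0 t; first exact: H.
  have nt : 0 <= - t by rewrite oppr_ge0 ltW.
  have := H (- t) nt; rewrite normrN.
  have -> : - t + h = - (t - h) by lra.
  have -> : - t - h = - (t + h) by lra.
  by rewrite !ssqrtN; lra.
have th0 : 0 < t + h by lra.
rewrite (ger0_norm t0) ler_pdivrMr ?sqrtr_gt0// /ssqrt (ltW th0).
have [th|th] := leP 0 (t - h).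
  have := sqr_sqrtr th; have := sqr_sqrtr (ltW th0).
  have := sqrtr_ge0 (t + h); have := sqrtr_ge0 (t - h).
  have : Num.sqrt (t - h) <= Num.sqrt (t + h) by apply: ler_wsqrtr; lra.
  move: (Num.sqrt (t - h)) (Num.sqrt (t + h)) => a b; nra.
have := sqr_sqrtr (ltW th0); have := sqrtr_ge0 (t + h); have := sqrtr_ge0 (- (t - h)).
move: (Num.sqrt (t + h)) (Num.sqrt (- (t - h))) => b a; nra.
Qed.

Lemma ssqrt_holder s d : 0 <= d -> ssqrt (s + d) - ssqrt s <= 2 * Num.sqrt d.
Proof.
move=> d0; have sd := sqr_sqrtr d0; have := sqrtr_ge0 d; move: sd.
move: (Num.sqrt d) => r sd r0; rewrite /ssqrt.
have [s0|s0] := leP 0 s.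
  have sd0 : 0 <= s + d by rewrite addr_ge0.
  rewrite sd0; have := sqr_sqrtr s0; have := sqr_sqrtr sd0.
  have := sqrtr_ge0 s; have := sqrtr_ge0 (s + d).
  move: (Num.sqrt s) (Num.sqrt (s + d)) => a b; nra.
have s0' : 0 <= - s by lra.
have [sd0|sd0] := leP 0 (s + d).
  have : Num.sqrt (- s) <= Num.sqrt d by apply: ler_wsqrtr; lra.
  have : Num.sqrt (s + d) <= Num.sqrt d by apply: ler_wsqrtr; lra.
  rewrite -sd sqrtr_sqr ger0_norm//; lra.
have sd0' : 0 <= - (s + d) by lra.
have := sqr_sqrtr s0'; have := sqr_sqrtr sd0'.
have := sqrtr_ge0 (- s); have := sqrtr_ge0 (- (s + d)).
move: (Num.sqrt (- s)) (Num.sqrt (- (s + d))) => a b; nra.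
Qed.

(** Discrete stand-in for the uniform law on [-1, 1], of mesh [2 / N]; the points
    are placed symmetrically so that random signs can be inserted. *)
Definition grid N (j : nat) : R := (2 * j%:R + 1 - N%:R) / N%:R.

Lemma grid_rev N (j : 'I_N) : grid N (rev_ord j) = - grid N j.
Proof.
rewrite /grid -mulNr; congr (_ / _).
by rewrite /= natrB ?ltn_ord// -natr1; lra.
Qed.

Lemma normr_grid_le1 N (j : 'I_N) : `|grid N j| <= 1.
Proof.
have N0 : 0 < N%:R :> R by rewrite ltr0n (leq_ltn_trans _ (ltn_ord j)).
rewrite normrM normfV (gtr0_norm N0) ler_pdivrMr// mul1r ler_norml.
have : j%:R + 1 <= N%:R :> R by rewrite natr1 ler_nat.
have : 0 <= j%:R :> R by []. 
by move=> ? ?; apply/andP; split; lra.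
Qed.

(** Discrete form of the uniform bound on the integral of |y + u c|^(-1/2) over
    u in [-1, 1]: each term is an increment of [ssqrt] and the sum telescopes.
    The regularisation [e] covers the mesh, since the points may hit zero. *)
Lemma grid_small_ball N y c e : c != 0 -> (0 < N)%N -> 2 * `|c| <= e * N%:R ->
  \sum_(j < N) (Num.sqrt (`|y + grid N j * c| + e))^-1 <= N%:R * (4 / Num.sqrt `|c|).
Proof.
wlog c0 : c / 0 < c => [H c0 N0|_ N0].
  have [|cn] := ltP 0 c; first by move/H; apply.
  rewrite -normrN => ce; have := H (- c); rewrite oppr_gt0 lt_neqAle c0 cn oppr_eq0.
  move=> /(_ isT c0 N0 ce); congr (_ <= _).
  rewrite [RHS](reindex_inj rev_ord_inj); apply: eq_bigr => j _.
  by rewrite grid_rev mulrN mulNr.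
rewrite (gtr0_norm c0) => ce; have N0' : 0 < N%:R :> R by rewrite ltr0n.
pose h := 2 * c / N%:R; have h0 : 0 < h by rewrite divr_gt0 ?mulr_gt0.
have he : h <= e by rewrite ler_pdivrMr.
(* The grid points are the [T j.+1], with neighbours [T j] and [T j.+2]. *)
pose T j := y - c - h / 2 + j%:R * h.
have TE j : y + grid N j * c = T j.+1.
  by rewrite /T /grid /h -natr1; field; rewrite gt_eqF.
have TS j : T j.+1 = T j + h by rewrite /T -natr1; ring.
have TN j : T (j + N)%N = T j + 2 * c.
  by rewrite /T natrD /h; field; rewrite gt_eqF.
apply: (@le_trans _ _ (\sum_(j < N) h^-1 * (ssqrt (T j.+2) - ssqrt (T j)))).
  apply: ler_sum => j _; rewrite TE.
  have := ssqrt_incr (T j.+1) h0; rewrite -TS {2}[T j.+1]TS addrK.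
  rewrite -ler_pdivlMl// => /(le_trans _); apply.
  rewrite ler_pV2 ?inE ?unitfE ?gt_eqF ?sqrtr_gt0 ?ltr_wpDl// ?(lt_le_trans h0)//.
  by apply: ler_wsqrtr; rewrite lerD2l.
rewrite -mulr_sumr.
have -> : \sum_(j < N) (ssqrt (T j.+2) - ssqrt (T j)) =
   (ssqrt (T 1%N + 2 * c) - ssqrt (T 1%N)) + (ssqrt (T 0%N + 2 * c) - ssqrt (T 0%N)).
  rewrite -!TN add0n add1n.
  rewrite -(telescope_sumr (fun j => ssqrt (T j.+1)) (leq0n N)).
  rewrite -(telescope_sumr (fun j => ssqrt (T j)) (leq0n N)) -big_split/= big_mkord.
  by apply: eq_bigr => j _; lra.
have c2 : 0 <= 2 * c by rewrite mulr_ge0 ?ltW.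
apply: (@le_trans _ _ (h^-1 * (2 * Num.sqrt (2 * c) + 2 * Num.sqrt (2 * c)))).
  by rewrite ler_pM2l ?invr_gt0// lerD ?ssqrt_holder.
have s0 : 0 < Num.sqrt c by rewrite sqrtr_gt0.
have cE : c = Num.sqrt c ^+ 2 by rewrite sqr_sqrtr// ltW.
have s2 : Num.sqrt (2 * c) <= 2 * Num.sqrt c.
  rewrite -(@ler_pXn2r _ 2)// ?nnegrE ?mulr_ge0 ?sqrtr_ge0//.
  by rewrite exprMn !sqr_sqrtr// ?(ltW c0)//; lra.
have -> : N%:R * (4 / Num.sqrt c) = h^-1 * (8 * Num.sqrt c).
  rewrite /h {2}cE; field; rewrite ?gt_eqF//.
by rewrite ler_pM2l ?invr_gt0//; lra.
Qed.

End SmallBall.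

(** * Finite probability *)

Section FiniteProbability.
Context (R : realType).

(** Exchanging the old and the new value of one coordinate is an involution, so
    resampling this coordinate preserves the uniform law. *)
Lemma sum_ffun_resample (I S : finType) (F : {ffun I -> S} -> R) (i : I) :
  \sum_(f : {ffun I -> S}) \sum_(s : S) F [ffun k => if k == i then s else f k] =
  #|S|%:R * \sum_f F f.
Proof.
pose up (f : {ffun I -> S}) s := [ffun k => if k == i then s else f k].
rewrite (pair_bigA _ (fun f s => F (up f s)))/=.
pose sw (fs : {ffun I -> S} * S) := (up fs.1 fs.2, fs.1 i).
have swK : involutive sw.
  move=> [f s]; rewrite /sw /up /= !ffunE eqxx; congr pair.
  by apply/ffunP => k; rewrite !ffunE; case: eqP => [->|].
rewrite (reindex_inj (inv_inj swK))/=.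
have -> : \sum_fs F (up (sw fs).1 (sw fs).2) = \sum_(fs : {ffun I -> S} * S) F fs.1.
  apply: eq_bigr => -[f s] _; congr F.
  by apply/ffunP => k; rewrite !ffunE /=; case: eqP => [->|].
rewrite -(pair_bigA _ (fun f (_ : S) => F f))/= mulr_sumr; apply: eq_bigr => f _.
by rewrite sumr_const mulr_natl.
Qed.

Lemma count_multiples (D : nat) (l b : R) : 0 < l ->
  Num.min D%:R (b / l - 1) <= \sum_(i < D) (i.+1%:R * l <= b)%R%:R.
Proof.
move=> l0; elim: D => [|D IH]; first by rewrite big_ord0 ge_min lexx.
rewrite big_ord_recr/=; have [h|h] := leP (D.+1%:R * l) b.
  rewrite ge_min; apply/orP; left; rewrite -natr1 lerD2r; apply: le_trans IH.
  by rewrite le_min lexx/= lerBrDr natr1 ler_pdivlMr.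
rewrite addr0 ge_min; apply/orP; right; apply: le_trans IH.
by rewrite le_min lexx andbT lerBlDr natr1 ler_pdivrMr// ltW.
Qed.

(** By independence the probability is at most the exponential of minus the
    expected number of indices [i] with [(i + 1) * l <= b (f i)]. This number is
    at least [1 / l - 1] because [b] has mean 1. *)
Lemma prob_all_small (D n : nat) (w b : 'I_n -> R) (l : R) :
  (forall k, 0 <= w k) -> \sum_k w k = 1 -> \sum_k w k * b k = 1 ->
  0 < l -> (forall k, b k <= D%:R * l) ->
  \sum_(f : {ffun 'I_D -> 'I_n})
     (\prod_i w (f i)) * [forall i : 'I_D, (b (f i) < i.+1%:R * l)%R]%:R <= l.
Proof.
move=> w0 w1 wb l0 bD.
apply: (@le_trans _ _ (\prod_(i < D) \sum_k w k * (b k < i.+1%:R * l)%R%:R)).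
  rewrite bigA_distr_bigA/=; apply: ler_sum => f _; rewrite big_split/=.
  apply: ler_wpM2l; first exact: prodr_ge0.
  case: forallP => [h|_]; last by apply: prodr_ge0 => i _; exact: ler0n.
  by rewrite big1// => i _; rewrite h.
pose c (i : 'I_D) := \sum_k w k * (i.+1%:R * l <= b k)%R%:R.
apply: (@le_trans _ _ (\prod_(i < D) expR (- c i))).
  apply: ler_prod => i _; apply/andP; split.
    by apply: sumr_ge0 => k _; rewrite mulr_ge0.
  apply: le_trans (expR_ge1Dx _).
  have -> : 1 - c i = \sum_k (w k - w k * (i.+1%:R * l <= b k)%R%:R) by rewrite sumrB w1.
  apply: ler_sum => k _; rewrite ltNge; case: (_ <= b k) => /=; lra.
rewrite -expR_sum sumrN.
apply: (@le_trans _ _ (expR (1 - l^-1))).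
  rewrite ler_expR lerNl opprB /c exchange_big/=.
  have -> : l^-1 - 1 = \sum_k w k * (b k / l - 1).
    under eq_bigr do rewrite mulrBr mulr1 mulrA.
    by rewrite sumrB w1 -mulr_suml wb mul1r.
  apply: ler_sum => k _; rewrite -mulr_sumr ler_wpM2l//.
  apply: le_trans (count_multiples D (b k) l0).
  by rewrite le_min lexx andbT lerBlDr ler_pdivrMr// (le_trans (bD k))// ler_pM2r// lerDl.
have := expR_ge1Dx (l^-1 - 1); rewrite addrC subrK => h.
rewrite -[1 - _]opprB expRN invf_ple ?posrE ?expR_gt0//.
Qed.

(** The dyadic levels below [v] already add up to [v]. *)
Lemma layer_cake (L : nat) (v : R) : v <= 2 ^+ L ->
  v <= 1 + \sum_(m < L) 2 ^+ m.+1 * (2 ^+ m < v)%R%:R.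
Proof.
elim: L => [|L IH]; first by rewrite big_ord0 addr0.
move=> vL; rewrite big_ord_recr/= addrA; have [h|h] := ltP (2 ^+ L) v; last first.
  by rewrite mulr0 addr0 IH.
by rewrite mulr1 (le_trans vL)// lerDr addr_ge0// sumr_ge0.
Qed.

(** Concavity at 1: with [t = expR y], the numbers 1 and [t] are
    [expR (r * y)] times exponentials that dominate their tangents, and the two
    first-order terms cancel in the mean with weights [1 - r] and [r]. *)
Lemma powR_tangent (r t : R) : 0 < r <= 1 -> 0 <= t -> t `^ r <= 1 + r * (t - 1).
Proof.
move=> /andP[r0 r1]; rewrite le_eqVlt => /predU1P[<-|t0].
  by rewrite powR0 ?gt_eqF//; lra.
rewrite /powR gt_eqF//; set y := ln t.
have tE : t = expR (r * y) * expR ((1 - r) * y).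
  by rewrite -expRD -mulrDl addrC subrK mul1r lnK.
have e0 : 0 < expR (r * y) := expR_gt0 _.
have h1 : 1 + (1 - r) * y <= expR ((1 - r) * y) := expR_ge1Dx _.
have h2 : 1 - r * y <= (expR (r * y))^-1 by rewrite -expRN expR_ge1Dx.
have h2' : expR (r * y) * (1 - r * y) <= 1 by rewrite -ler_pdivlMl ?mulr1.
have h1' : expR (r * y) * (1 + (1 - r) * y) <= t by rewrite tE ler_pM2l.
nra.
Qed.

Lemma jensen_powR (I : finType) (w Z : I -> R) (r M : R) : 0 < r <= 1 ->
  (forall i, 0 <= w i) -> (forall i, 0 <= Z i) -> \sum_i w i = 1 -> 0 < M ->
  \sum_i w i * Z i <= M -> \sum_i w i * Z i `^ r <= M `^ r.
Proof.
move=> r01 w0 Z0 w1 M0 ZM; have /andP[r0 r1] := r01.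
apply: (@le_trans _ _ (\sum_i w i * (M `^ r * (1 + r * (Z i / M - 1))))).
  apply: ler_sum => i _; apply: ler_wpM2l => //.
  rewrite -{1}(divfK (lt0r_neq0 M0) (Z i)) powRM ?divr_ge0 ?(ltW M0)//.
  by rewrite mulrC ler_wpM2l ?powR_ge0// powR_tangent ?divr_ge0 ?(ltW M0).
have -> : \sum_i w i * (M `^ r * (1 + r * (Z i / M - 1))) =
    M `^ r * (1 + r * ((\sum_i w i * Z i) / M - 1)).
  have -> : 1 + r * ((\sum_i w i * Z i) / M - 1) =
     \sum_i (w i + r * (w i * Z i / M - w i)).
    by rewrite big_split/= -mulr_sumr sumrB -mulr_suml w1.
  rewrite mulr_sumr; apply: eq_bigr => i _; ring.
rewrite -[leRHS]mulr1 ler_wpM2l ?powR_ge0//.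
have : (\sum_i w i * Z i) / M <= 1 by rewrite ler_pdivrMr// mul1r.
nra.
Qed.

(** The function [v `^ (- 2 * p)] lies above its tangent at 1, and it is applied to
    [v = (c * sqrt U)^-1], whose mean is at most 1. Unlike a bound by a
    probability, this one does not deteriorate when [p] tends to 0. *)
Lemma neg_moment_powR (I : finType) (w U : I -> R) (p c : R) : 0 < p -> 0 < c ->
  (forall i, 0 <= w i) -> (forall i, 0 < U i) -> \sum_i w i = 1 ->
  \sum_i w i * (Num.sqrt (U i))^-1 <= c ->
  (c ^- 2) `^ p <= \sum_i w i * U i `^ p.
Proof.
move=> p0 c0 w0 U0 w1 Uc.
have tang (u : R) : 0 < u ->
    (c ^- 2) `^ p * (1 - 2 * p * ((c * Num.sqrt u)^-1 - 1)) <= u `^ p.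
  move=> u0; have s0 : 0 < Num.sqrt u by rewrite sqrtr_gt0.
  have cs0 : 0 < c * Num.sqrt u by rewrite mulr_gt0.
  rewrite [leRHS](_ : _ = (c ^- 2) `^ p * ((c * Num.sqrt u) ^+ 2) `^ p); last first.
    rewrite -powRM ?invr_ge0 ?exprn_ge0 ?(ltW cs0) ?(ltW c0)//; congr (_ `^ _).
    by rewrite exprMn mulKf ?sqr_sqrtr ?(ltW u0)// expf_neq0// gt_eqF.
  rewrite ler_wpM2l ?powR_ge0//.
  rewrite /powR gt_eqF ?exprn_gt0// lnXn//; apply: le_trans (expR_ge1Dx _).
  have hl : 1 - (c * Num.sqrt u)^-1 <= ln (c * Num.sqrt u).
    have := expR_ge1Dx (ln (c * Num.sqrt u)^-1).
    by rewrite lnK ?posrE ?invr_gt0// lnV ?posrE//; lra.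
  by have := ler_wpM2l (ltW p0) hl; lra.
apply: (@le_trans _ _ (\sum_i w i * ((c ^- 2) `^ p * (1 - 2 * p * ((c * Num.sqrt (U i))^-1 - 1))))).
  have -> : \sum_i w i * ((c ^- 2) `^ p * (1 - 2 * p * ((c * Num.sqrt (U i))^-1 - 1))) =
    (c ^- 2) `^ p * (1 - 2 * p * (c^-1 * (\sum_i w i * (Num.sqrt (U i))^-1) - 1)).
    have -> : 1 - 2 * p * (c^-1 * (\sum_i w i * (Num.sqrt (U i))^-1) - 1) =
      \sum_i (w i - 2 * p * (c^-1 * (w i * (Num.sqrt (U i))^-1) - w i)).
      by rewrite sumrB -mulr_sumr sumrB -mulr_sumr w1.
    rewrite mulr_sumr; apply: eq_bigr => i _; rewrite [(c * Num.sqrt _)^-1]invfM.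
    move: (c^-1) (Num.sqrt (U i))^-1 ((c ^- 2) `^ p) => a b d; ring.
  rewrite -[leLHS]mulr1 ler_wpM2l ?powR_ge0//.
  have : c^-1 * (\sum_i w i * (Num.sqrt (U i))^-1) <= 1 by rewrite ler_pdivrMl// mulr1.
  nra.
by apply: ler_sum => i _; rewrite ler_wpM2l// tang.
Qed.

End FiniteProbability.

(** * Discrete stable variables *)

Section SeriesBound.
Context (R : realType).

(** Bernoulli's inequality bounds [k `^ (- q)] by a multiple of an increment of
    [k `^ (1 - q)]. *)
Lemma sum_powR_le (q : R) (D : nat) : 1 < q ->
  \sum_(i < D) (i.+1%:R^-1) `^ q <= q / (q - 1).
Proof.
move=> q1; have r0 : 0 < q - 1 by lra.
suff H : \sum_(i < D.+1) (i.+1%:R^-1) `^ q <= q / (q - 1) - (q - 1)^-1 * (D.+1%:R^-1) `^ (q - 1).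
  rewrite big_ord_recr/= in H; apply: (le_trans _ (le_trans H _)).
    by rewrite lerDl powR_ge0.
  by rewrite lerBlDr lerDl mulr_ge0 ?powR_ge0// invr_ge0 ltW.
elim: D => [|D IH].
  rewrite big_ord_recr/= big_ord0 add0r invr1 !powR1 mulr1.
  by rewrite -[X in _ - X]mul1r -mulrBl divff// gt_eqF.
rewrite big_ord_recr/=; apply: le_trans (lerD IH (lexx _)) _.
set a : R := D.+1%:R; have a0 : 0 < a by rewrite ltr0n.
have -> : D.+2%:R = a + 1 :> R by rewrite natr1.
have a1 : 0 < a + 1 by lra.
suff key : (q - 1) * ((a + 1)^-1) `^ q <= (a^-1) `^ (q - 1) - ((a + 1)^-1) `^ (q - 1).
  by move: key; rewrite -ler_pdivlMl// mulrBr; lra.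
have -> : ((a + 1)^-1) `^ q = (a + 1)^-1 * ((a + 1)^-1) `^ (q - 1).
  by rewrite mulr_powRB1// ?invr_ge0 ?(ltW a1)//; lra.
have -> : a^-1 = (a + 1)^-1 * ((a + 1) / a) by field; rewrite ?gt_eqF.
rewrite [in leRHS]powRM ?divr_ge0 ?invr_ge0 ?(ltW a0) ?(ltW a1)//.
move: (((a + 1)^-1) `^ (q - 1)) (powR_ge0 (a + 1)^-1 (q - 1)) => v v0.
have -> : forall u : R, v * u - v = v * (u - 1) by move=> u; ring.
rewrite mulrA mulrC ler_wpM2l//.
rewrite /powR gt_eqF ?divr_gt0// lerBrDl; apply: le_trans (expR_ge1Dx _).
rewrite lerD2l ler_pM2l//.
have := expR_ge1Dx (ln (a / (a + 1))); rewrite lnK ?posrE ?divr_gt0//.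
rewrite -[a / (a + 1)]invf_div lnV ?posrE ?divr_gt0// invf_div.
have -> : a / (a + 1) = 1 - (a + 1)^-1 by field; rewrite gt_eqF.
lra.
Qed.

Lemma sum_geometric L : \sum_(m < L) 2 ^+ m.+1 * 4 ^- m = 4 - 4 * 2 ^- L :> R.
Proof.
elim: L => [|L IH]; first by rewrite big_ord0 expr0 invr1; lra.
rewrite big_ord_recr/= IH.
have -> : 4 ^- L = 2 ^- L * 2 ^- L :> R.
  by rewrite -invfM -exprMn; congr (_ ^+ _)^-1; rewrite -natrM.
have : 2 ^+ L != 0 :> R by rewrite expf_neq0// pnatr_eq0.
rewrite !exprS; move: (2 ^+ L) => u u0.
by field.
Qed.

End SeriesBound.

Section StableForms.
Context (R : realType) (n D N : nat).
Implicit Types (th : {ffun 'I_D -> 'I_N}) (ka : {ffun 'I_D -> 'I_n}).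

(** Discrete substitute for a 1-stable combination of the vectors [y k], following
    LePage's series: the jumps have the deterministic sizes [1 / (i + 1)], random
    positions [ka] and random coefficients [grid (th i)]. Deterministic sizes
    keep the mean norm bounded, so that the constants are uniform up to [p = 1]. *)
Definition lepage (V : lmodType R) th ka (y : 'I_n -> V) : V :=
  \sum_i (grid R N (th i) / i.+1%:R) *: y (ka i).

Definition lepage_coef th ka (w : 'I_n -> R) (k : 'I_n) : R :=
  \sum_(i | ka i == k) grid R N (th i) / i.+1%:R / w k.

Lemma lepage_coefE (V : lmodType R) th ka w (v : 'I_n -> V) :
  \sum_k lepage_coef th ka w k *: v k = lepage th ka (fun k => (w k)^-1 *: v k).
Proof.
rewrite /lepage (partition_big ka predT)//=; apply: eq_bigr => k _.
rewrite /lepage_coef scaler_suml; apply: eq_bigr => i /eqP ->.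
by rewrite scalerA.
Qed.

(** Given the other coefficients, the [i]-th one is uniform on the grid, whatever
    the index [i] is; so the largest jump may be used. *)
Lemma lepage_small_ball ka (b : 'I_n -> R^o) (e : R) i : (0 < N)%N ->
  b (ka i) != 0 -> (forall k, 2 * `|b k| <= e * N%:R) ->
  (N ^ D)%:R^-1 * \sum_(th : {ffun 'I_D -> 'I_N}) (Num.sqrt (`|lepage th ka b| + e))^-1
    <= 4 / Num.sqrt (`|b (ka i)| / i.+1%:R).
Proof.
move=> N0 bi be; have N0' : 0 < N%:R :> R by rewrite ltr0n.
rewrite ler_pdivrMl ?ltr0n ?expn_gt0 ?N0//.
rewrite -(ler_pM2l N0') -{1}(card_ord N) -(sum_ffun_resample _ i).
apply: (@le_trans _ _ (\sum_(th : {ffun 'I_D -> 'I_N}) N%:R * (4 / Num.sqrt (`|b (ka i)| / i.+1%:R)))); last first.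
  by rewrite sumr_const card_ffun !card_ord -[leLHS]mulr_natl mulrCA.
apply: ler_sum => th _; pose c := b (ka i) / i.+1%:R.
pose y := \sum_(j | j != i) grid R N (th j) / j.+1%:R * b (ka j).
have -> : `|b (ka i)| / i.+1%:R = `|c| by rewrite normrM normfV (ger0_norm (ler0n _ _)).
have c0 : c != 0 by rewrite mulf_neq0// invr_eq0 pnatr_eq0.
have ce : 2 * `|c| <= e * N%:R.
  apply: le_trans (be (ka i)); rewrite ler_pM2l// normrM ler_piMr//.
  by rewrite normfV ger0_norm ?ler0n// invf_le1 ?ltr0n// ler1n.
have := grid_small_ball y c0 N0 ce; congr (_ <= _); apply: eq_bigr => s _.
congr (Num.sqrt (`|_| + _))^-1; rewrite /lepage (bigD1 i)//= ffunE eqxx addrC.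
congr (_ + _); first by apply: eq_bigr => j ji; rewrite ffunE (negbTE ji).
by rewrite /c mulrA mulrAC.
Qed.

(** The small-ball estimate bounds the conditional expectation by the largest jump
    to the power -1/2, and all the jumps are below [4 ^- m] with probability at
    most [4 ^- m]; the layers sum up geometrically. *)
Lemma lepage_neg_moment (w : 'I_n -> R) (b : 'I_n -> R^o) (e : R) (L : nat) :
  (forall k, 0 <= w k) -> \sum_k w k = 1 -> \sum_k w k * `|b k| = 1 ->
  0 < e -> (0 < N)%N -> (forall k, 2 * `|b k| <= e * N%:R) ->
  (Num.sqrt e)^-1 <= 4 * 2 ^+ L -> (forall k, `|b k| * 4 ^+ L <= D%:R) ->
  \sum_(ka : {ffun 'I_D -> 'I_n}) (\prod_i w (ka i)) *
     ((N ^ D)%:R^-1 * \sum_(th : {ffun 'I_D -> 'I_N}) (Num.sqrt (`|lepage th ka b| + e))^-1) <= 20.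
Proof.
move=> w0 w1 wb e0 N0 be eL bD.
pose V ka := (N ^ D)%:R^-1 * \sum_(th : {ffun 'I_D -> 'I_N}) (Num.sqrt (`|lepage th ka b| + e))^-1.
have ND0 : 0 < (N ^ D)%:R :> R by rewrite ltr0n expn_gt0 N0.
have VL ka : V ka / 4 <= 2 ^+ L.
  rewrite ler_pdivrMr// mulrC; apply: le_trans eL.
  rewrite ler_pdivrMl//; apply: (@le_trans _ _ (\sum_(th : {ffun 'I_D -> 'I_N}) (Num.sqrt e)^-1)).
    apply: ler_sum => th _; rewrite ler_pV2 ?inE ?unitfE ?gt_eqF ?sqrtr_gt0 ?ltr_wpDl//.
    by apply: ler_wsqrtr; rewrite lerDr.
  by rewrite sumr_const card_ffun !card_ord mulr_natl.
pose P ka m := (\prod_i w (ka i)) * [forall i : 'I_D, (`|b (ka i)| < i.+1%:R * 4 ^- m)%R]%:R.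
have Vm ka m : (2 ^+ m < V ka / 4)%R -> [forall i : 'I_D, (`|b (ka i)| < i.+1%:R * 4 ^- m)%R].
  move=> mV; apply/forallP => i; have i0 : 0 < i.+1%:R :> R by rewrite ltr0n.
  have [->|bi] := eqVneq (b (ka i)) 0.
    by rewrite normr0 mulr_gt0// invr_gt0 exprn_gt0.
  have := lt_le_trans mV (ler_wpM2r _ (lepage_small_ball N0 bi be)).
  rewrite invr_ge0 => /(_ (ler0n _ 4)); set c := `|b (ka i)| / i.+1%:R.
  have c0 : 0 < c by rewrite divr_gt0// normr_gt0.
  have sc : 0 < Num.sqrt c by rewrite sqrtr_gt0.
  rewrite mulrAC divff ?pnatr_eq0// mul1r -[X in X < _]invrK ltf_pV2 ?posrE ?invr_gt0 ?exprn_gt0//.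
  move=> h; rewrite mulrC -ltr_pdivrMr// -/c -(sqr_sqrtr (ltW c0)).
  have -> : 4 ^- m = (2 ^- m) ^+ 2 :> R.
    by rewrite exprVn -exprM mulnC exprM; congr (_ ^+ _)^-1; rewrite -natrX.
  by rewrite ltrXn2r// ?nnegrE ?sqrtr_ge0 ?invr_ge0 ?exprn_ge0.
have PL m : (m < L)%N -> \sum_(ka : {ffun 'I_D -> 'I_n}) P ka m <= 4 ^- m.
  move=> mL; apply: (@prob_all_small _ _ _ w (fun k => `|b k|) _ w0 w1 wb).
    by rewrite invr_gt0 exprn_gt0.
  move=> k; rewrite ler_pdivlMr ?exprn_gt0//; apply: le_trans (bD k).
  by rewrite ler_wpM2l// ler_eXn2l ?(ltnW mL)// ltr1n.
apply: (@le_trans _ _ (\sum_(ka : {ffun 'I_D -> 'I_n}) 4 * ((\prod_i w (ka i)) + \sum_(m < L) 2 ^+ m.+1 * P ka m))).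
  apply: ler_sum => ka _; rewrite -/(V ka).
  have w'0 : 0 <= \prod_i w (ka i) by apply: prodr_ge0.
  have -> : V ka = 4 * (V ka / 4) by field.
  rewrite mulrCA ler_pM2l//.
  apply: le_trans (ler_wpM2l w'0 (layer_cake (VL ka))) _.
  rewrite mulrDr mulr1 lerD2l mulr_sumr; apply: ler_sum => m _.
  rewrite mulrCA ler_wpM2l ?exprn_ge0// ler_wpM2l//.
  by case: ltP => [/Vm ->//|_]; exact: ler0n.
rewrite -mulr_sumr big_split/= exchange_big/=.
have -> : \sum_(ka : {ffun 'I_D -> 'I_n}) \prod_i w (ka i) = 1.
  rewrite -(bigA_distr_bigA (fun _ k => w k))/= big1// => i _; exact: w1.
have -> : 20 = 4 * (1 + 4) :> R by lra.
rewrite ler_pM2l// lerD2l.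
apply: (@le_trans _ _ (\sum_(m < L) 2 ^+ m.+1 * 4 ^- m)).
  by apply: ler_sum => m _; rewrite -mulr_sumr ler_wpM2l ?exprn_ge0// PL.
by rewrite sum_geometric lerBlDr lerDl mulr_ge0 ?invr_ge0 ?exprn_ge0.
Qed.

End StableForms.

(** * Linear forms adapted to a space with non-trivial type *)

Section TypeForms.
Context (R : realType) (E : normedModType R) (q K : R) (q1 : 1 < q) (K0 : 0 < K).
Context (typeE : forall n (x : 'I_n -> E),
  ((2 ^+ n)^-1 *
     \sum_(s : {ffun 'I_n -> bool}) `|\sum_(k < n) (-1) ^+ s k *: x k| `^ q) `^ q^-1
    <= K * (\sum_(k < n) `|x k| `^ q) `^ q^-1).

Let q0 : 0 < q. Proof. exact: lt_trans q1. Qed.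

Lemma type_sum_signs n (x : 'I_n -> E) :
  \sum_(s : {ffun 'I_n -> bool}) `|\sum_(k < n) (-1) ^+ s k *: x k| `^ q
    <= 2 ^+ n * (K `^ q * \sum_(k < n) `|x k| `^ q).
Proof.
have S0 : 0 <= \sum_(k < n) `|x k| `^ q by apply: sumr_ge0 => k _; exact: powR_ge0.
rewrite -ler_pdivrMl ?exprn_gt0//; apply: (@powR_cancel_le _ q^-1).
- by rewrite invr_gt0.
- by rewrite mulr_ge0 ?invr_ge0 ?exprn_ge0// sumr_ge0// => s _; exact: powR_ge0.
- by rewrite mulr_ge0 ?powR_ge0.
- by rewrite [leRHS]powRM ?powR_ge0// powR_invK ?(ltW K0)//; exact: typeE.
Qed.

(** The grid is symmetric, so its points can be given independent random signs. *)
Lemma type_sum_grid D N (z : 'I_D -> E) :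
  \sum_(th : {ffun 'I_D -> 'I_N}) `|\sum_i grid R N (th i) *: z i| `^ q
    <= (N ^ D)%:R * (K `^ q * \sum_i `|z i| `^ q).
Proof.
pose fl (s : {ffun 'I_D -> bool}) (th : {ffun 'I_D -> 'I_N}) :=
  [ffun i => if s i then rev_ord (th i) else th i].
have flK s : involutive (fl s).
  by move=> th; apply/ffunP => i; rewrite !ffunE; case: (s i) => //; rewrite rev_ordK.
pose G (th : {ffun 'I_D -> 'I_N}) := `|\sum_i grid R N (th i) *: z i| `^ q.
have GE s th : G (fl s th) = `|\sum_i (-1) ^+ s i *: (grid R N (th i) *: z i)| `^ q.
  congr (`|_| `^ _); apply: eq_bigr => i _; rewrite ffunE; case: (s i).
    by rewrite grid_rev expr1 scaleN1r scaleNr.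
  by rewrite expr0 scale1r.
have cE : #|{ffun 'I_D -> bool}|%:R = 2 ^+ D :> R.
  by rewrite card_ffun card_bool card_ord natrX.
rewrite -(@ler_pM2l _ (2 ^+ D)) ?exprn_gt0//.
have -> : 2 ^+ D * \sum_th G th = \sum_th \sum_(s : {ffun 'I_D -> bool}) G (fl s th).
  rewrite exchange_big/= -cE mulr_natl -sumr_const; apply: eq_bigr => s _.
  by rewrite [LHS](reindex_inj (inv_inj (flK s))).
apply: (@le_trans _ _ (\sum_(th : {ffun 'I_D -> 'I_N}) 2 ^+ D * (K `^ q * \sum_i `|z i| `^ q))); last first.
  by rewrite sumr_const card_ffun !card_ord -[leLHS]mulr_natl mulrCA.
apply: ler_sum => th _; under eq_bigr do rewrite GE.
apply: le_trans (type_sum_signs _) _.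
rewrite ler_wpM2l ?exprn_ge0// ler_wpM2l ?powR_ge0//; apply: ler_sum => i _.
by rewrite powR_le ?(ltW q0)// normrZ ler_piMl// normr_grid_le1.
Qed.

Let K' := K * (q / (q - 1)) `^ q^-1.

Let K'_gt0 : 0 < K'.
Proof. by rewrite mulr_gt0 ?powR_gt0 ?divr_gt0 ?subr_gt0. Qed.

(** The sizes [1 / (i + 1)] are q-summable because [1 < q]. *)
Lemma type_lepage n D N ka (y : 'I_n -> E) (W : R) : 0 <= W -> (forall k, `|y k| <= W) ->
  \sum_(th : {ffun 'I_D -> 'I_N}) `|lepage th ka y| `^ q <= (N ^ D)%:R * (K' * W) `^ q.
Proof.
move=> W0 yW; rewrite /lepage; under eq_bigr do under eq_bigr do rewrite -scalerA.
apply: le_trans (type_sum_grid _ _) _; rewrite ler_wpM2l ?ler0n//.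
have qq : 0 <= q / (q - 1) by rewrite divr_ge0 ?subr_ge0 ?ltW.
have -> : (K' * W) `^ q = K `^ q * (q / (q - 1) * W `^ q).
  rewrite (powRM q (ltW K'_gt0) W0) (powRM q (ltW K0) (powR_ge0 _ _)).
  by rewrite (powR_Vinv q0 qq) [RHS]mulrA.
rewrite ler_wpM2l ?powR_ge0//.
apply: (@le_trans _ _ (\sum_(i < D) (i.+1%:R^-1) `^ q * W `^ q)).
  apply: ler_sum => i _; rewrite normrZ powRM// ger0_norm ?invr_ge0 ?ler0n//.
  by rewrite ler_wpM2l ?powR_ge0// powR_le// (ltW q0).
by rewrite -mulr_suml ler_wpM2r ?powR_ge0// sum_powR_le.
Qed.

(** The forms are the values of [lepage] for weights proportional to [c],
    multiplied by [pr o `^ p^-1] so that their l_p-norm is an L_p-norm. Type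
    bounds the norms of the vectors; the negative moment bounds the forms from
    below, after addition of small multiples of the coordinates, without which
    all forms could vanish at some [a]. *)
Lemma type_forms : exists2 C : R, 0 < C &
  forall p : R, 0 < p <= 1 -> forall n (x : 'I_n -> E) (c : 'I_n -> R),
    (forall k, 0 < c k) -> (forall k, `|x k| <= c k) ->
  exists (J : finType) (A : J -> 'I_n -> R),
    (forall a : 'I_n -> R, \sum_k `|a k| <= (\sum_j `|\sum_k A j k * a k| `^ p) `^ p^-1) /\
    (\sum_j `|\sum_k A j k *: x k| `^ p) `^ p^-1 <= C * \sum_k c k.
Proof.
(* The constant of [lepage_neg_moment] is 20, and a moment of order -1/2 costs
   its square. *)
have [c4 c40 c4E] : exists2 c4 : R, 0 < c4 & c4 = 20 ^+ 2.
  by exists (20 ^+ 2); [apply: exprn_gt0; rewrite ltr0n|].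
have c4ge := ltW c40.
exists (2 * c4 * K'); first by rewrite mulr_gt0// mulr_gt0.
move=> p p01 [|n] x c c0 xc.
  exists 'I_0, (fun _ _ => 0); split=> [a|]; first by rewrite big_ord0 powR_ge0.
  by rewrite !big_ord0 mulr0 powR0// invr_neq0// gt_eqF//; case/andP: p01.
have /andP[p0 p1] := p01.
pose W := \sum_k c k.
have W0 : 0 < W.
  by rewrite /W big_ord_recl/= ltr_pwDl// sumr_ge0// => k _; exact: ltW.
pose w k := c k / W; have w0 k : 0 < w k by rewrite divr_gt0.
have w1 : \sum_k w k = 1 by rewrite -mulr_suml divff// gt_eqF.
have KW0 : 0 < K' * W by rewrite mulr_gt0.
(* The regularising forms [e * a k] are made so cheap that they at most double
   the total. *)
have [e e0 ec] : exists2 e : R, 0 < e &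
    e `^ p * \sum_k c k `^ p <= (K' * W) `^ p * (2 `^ p - 1).
  have S0 : 0 < \sum_k c k `^ p.
    by rewrite big_ord_recl/= ltr_pwDl ?powR_gt0// sumr_ge0// => k _; exact: powR_ge0.
  have d0 : 0 < (K' * W) `^ p * (2 `^ p - 1) / \sum_k c k `^ p.
    rewrite divr_gt0// mulr_gt0 ?powR_gt0// subr_gt0.
    have : 1 `^ p < 2 `^ p :> R by rewrite gt0_ltr_powR ?nnegrE// ltr1n.
    by rewrite powR1.
  exists (((K' * W) `^ p * (2 `^ p - 1) / \sum_k c k `^ p) `^ p^-1); first exact: powR_gt0.
  by rewrite powR_Vinv ?(ltW d0)// divfK// gt_eqF.
pose B := \sum_k (w k)^-1.
have wB k : (w k)^-1 <= B.
  by rewrite /B (bigD1 k)//= lerDl sumr_ge0// => i _; rewrite invr_ge0 ltW.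
have B0 : 0 <= B by rewrite sumr_ge0// => i _; rewrite invr_ge0 ltW.
(* [N] makes the mesh finer than [e], [L] levels reach down to [e], and [D] picks
   suffice for the lowest level; none of them depends on [a]. *)
have [N N0 eN] : exists2 N, (0 < N)%N & 2 * B <= e * N%:R.
  exists (Num.bound (2 * B / e)).+1 => //; rewrite [e * _]mulrC -ler_pdivrMr//.
  have : 0 <= 2 * B / e by rewrite divr_ge0 ?mulr_ge0 ?(ltW e0).
  by move=> /archi_boundP/ltW/le_trans; apply; rewrite ler_nat.
have [L eL] : exists L, (Num.sqrt e)^-1 <= 4 * 2 ^+ L.
  exists (Num.bound (Num.sqrt e)^-1).
  have := @upper_nthrootP _ (Num.sqrt e)^-1 _ (leqnn _); move: (2 ^+ _) => u.
  have : 0 <= (Num.sqrt e)^-1 by rewrite invr_ge0 sqrtr_ge0.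
  by lra.
have [D BD] : exists D : nat, B * 4 ^+ L <= D%:R.
  exists (Num.bound (B * 4 ^+ L)); apply/ltW/archi_boundP.
  by rewrite mulr_ge0 ?exprn_ge0.
pose O := ({ffun 'I_D -> 'I_N} * {ffun 'I_D -> 'I_n.+1})%type.
pose pr (o : O) := (\prod_i w (o.2 i)) * (N ^ D)%:R^-1.
have pr0 o : 0 <= pr o by rewrite mulr_ge0 ?invr_ge0 ?ler0n// prodr_ge0// => i _; exact: ltW.
have ND0 : (N ^ D)%:R != 0 :> R by rewrite pnatr_eq0 -lt0n expn_gt0 N0.
have Epr (G : O -> R) : \sum_o pr o * G o = \sum_(ka : {ffun 'I_D -> 'I_n.+1})
    (\prod_i w (ka i)) * ((N ^ D)%:R^-1 * \sum_(th : {ffun 'I_D -> 'I_N}) G (th, ka)).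
  transitivity (\sum_(th : {ffun 'I_D -> 'I_N}) \sum_(ka : {ffun 'I_D -> 'I_n.+1})
      pr (th, ka) * G (th, ka)).
    by rewrite pair_bigA/=; apply: eq_bigr => -[].
  rewrite exchange_big/=.
  apply: eq_bigr => ka _; rewrite !mulr_sumr; apply: eq_bigr => th _.
  by rewrite /pr/= mulrA.
have prw : \sum_(ka : {ffun 'I_D -> 'I_n.+1}) \prod_i w (ka i) = 1.
  rewrite -(bigA_distr_bigA (fun _ k => w k))/=.
  by apply: big1 => i _; exact: w1.
have pr1 : \sum_o pr o = 1.
  have := Epr (fun=> 1); under eq_bigr do rewrite mulr1; move=> ->.
  under eq_bigr do rewrite sumr_const card_ffun !card_ord mulVf// mulr1.
  exact: prw.
pose A (j : O + 'I_n.+1) (k : 'I_n.+1) : R := match j with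
  | inl o => c4 * pr o `^ p^-1 * lepage_coef o.1 o.2 w k
  | inr i => c4 * (e * (i == k)%:R) end.
have Asum (V : normedModType R) (v : 'I_n.+1 -> V) :
    \sum_j `|\sum_k A j k *: v k| `^ p = c4 `^ p *
      (\sum_o pr o * `|lepage o.1 o.2 (fun k => (w k)^-1 *: v k)| `^ p +
       e `^ p * \sum_k `|v k| `^ p).
  rewrite big_sumType/= mulrDr; congr (_ + _).
    rewrite mulr_sumr; apply: eq_bigr => o _.
    under eq_bigr do rewrite -scalerA; rewrite -scaler_sumr lepage_coefE normrZ.
    rewrite powRM// ger0_norm ?mulr_ge0 ?powR_ge0// powRM ?powR_ge0//.
    by rewrite powR_Vinv// mulrA.
  rewrite !mulr_sumr; apply: eq_bigr => i _.
  rewrite (bigD1 i)//= eqxx mulr1 big1 ?addr0; last first.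
    by move=> k /negbTE ki; rewrite eq_sym ki !mulr0 scale0r.
  by rewrite normrZ powRM// ger0_norm ?mulr_ge0 ?(ltW e0)// powRM ?(ltW e0)// mulrA.
exists (O + 'I_n.+1)%type, A; split=> [a|]; last first.
  rewrite -/W; apply: (@powR_cancel_le _ p) => //; first exact: powR_ge0.
    by rewrite -mulrA; apply: mulr_ge0; [exact: mulr_ge0|exact: ltW].
  rewrite powR_Vinv ?sumr_ge0// Asum.
  rewrite -mulrA (powRM _ (mulr_ge0 _ c4ge) (ltW KW0))//.
  have -> : (2 * c4) `^ p = c4 `^ p * 2 `^ p :> R by rewrite mulrC powRM.
  rewrite -mulrA ler_wpM2l ?powR_ge0//.
  have h1 : e `^ p * \sum_k `|x k| `^ p <= e `^ p * \sum_k c k `^ p.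
    rewrite ler_wpM2l ?powR_ge0//; apply: ler_sum => k _.
    by rewrite powR_le// ltW.
  suff h2 : \sum_o pr o * `|lepage o.1 o.2 (fun k => (w k)^-1 *: x k)| `^ p <= (K' * W) `^ p.
    by apply: (le_trans (lerD h2 (le_trans h1 ec))); lra.
  have pq : 0 < p / q <= 1.
    by rewrite divr_gt0//= ler_pdivrMr// mul1r (le_trans p1)// ltW.
  pose Z (o : O) := `|lepage o.1 o.2 (fun k => (w k)^-1 *: x k)| `^ q.
  have ZE (o : O) : `|lepage o.1 o.2 (fun k => (w k)^-1 *: x k)| `^ p = Z o `^ (p / q).
    by rewrite /Z -powRrM mulrC divfK// gt_eqF.
  under eq_bigr do rewrite ZE.
  have -> : (K' * W) `^ p = ((K' * W) `^ q) `^ (p / q).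
    by rewrite -powRrM [q * _]mulrC divfK// gt_eqF.
  apply: jensen_powR => //; first by move=> o; exact: powR_ge0.
    exact: powR_gt0.
  rewrite Epr; apply: (@le_trans _ _ (\sum_(ka : {ffun 'I_D -> 'I_n.+1}) (\prod_i w (ka i)) * (K' * W) `^ q)).
    apply: ler_sum => ka _; rewrite ler_wpM2l ?prodr_ge0// => [i _|]; first exact: ltW.
    rewrite ler_pdivrMl ?lt0r ?ND0 ?ler0n//; apply: type_lepage; first exact: ltW.
    move=> k; rewrite normrZ ger0_norm ?invr_ge0 ?(ltW (w0 k))//.
    rewrite ler_pdivrMl//; apply: le_trans (xc k) _.
    by rewrite /w divfK// gt_eqF.
  by rewrite -mulr_suml prw mul1r.
pose S := \sum_k `|a k|; have : 0 <= S by exact: sumr_ge0.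
rewrite le_eqVlt => /predU1P[S0|S0]; first by rewrite -/S -S0 powR_ge0.
apply: powR_le_inv => //; first exact: ltW.
have := Asum R^o a; rewrite /GRing.scale/= => ->.
(* The forms are tested on the normalised values [b], of mean modulus 1 for the
   weights [w]. *)
pose b k : R^o := a k / (S * w k).
have bE k : w k * `|b k| = `|a k| / S.
  rewrite normrM normfV (gtr0_norm (mulr_gt0 S0 (w0 k))).
  by field; rewrite !gt_eqF.
have wb : \sum_k w k * `|b k| = 1.
  under eq_bigr do rewrite bE.
  by rewrite -mulr_suml divff// gt_eqF.
have bB k : `|b k| <= B.
  apply: le_trans (wB k); rewrite -[leRHS]mul1r ler_pdivlMr// mulrC -wb.
  by rewrite (bigD1 k)//= lerDl sumr_ge0// => i _; rewrite mulr_ge0 ?(ltW (w0 i)).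
have := @neg_moment_powR R O pr (fun o => `|lepage o.1 o.2 b| + e) p 20 p0.
have U0 (o : O) : 0 < `|lepage o.1 o.2 b| + e by rewrite ltr_wpDl.
move=> /(_ _ pr0 U0 pr1); rewrite ltr0n => /(_ isT).
rewrite Epr/= => /(_ (lepage_neg_moment _ w1 wb e0 N0 _ eL _)).
have be k : 2 * `|b k| <= e * N%:R by apply: le_trans eN; rewrite ler_pM2l.
have bD k : `|b k| * 4 ^+ L <= D%:R by apply: le_trans BD; rewrite ler_wpM2r ?exprn_ge0.
move=> /(_ (fun k => ltW (w0 k)) be bD) key.
have {key} : (20 ^- 2) `^ p <= \sum_o pr o * `|lepage o.1 o.2 b| `^ p + e `^ p.
  apply: le_trans key _; rewrite -[X in _ + X]mul1r -pr1 mulr_suml -big_split/=.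
  by apply: ler_sum => o _; rewrite -mulrDr ler_wpM2l// powR_leD// ltW.
have lE (o : O) : lepage o.1 o.2 b = S^-1 * lepage o.1 o.2 (fun k => (w k)^-1 * a k : R^o).
  rewrite /lepage mulr_sumr; apply: eq_bigr => i _; rewrite /b /GRing.scale/= invfM.
  by ring.
have SV0 : 0 <= S^-1 by rewrite invr_ge0 ltW.
have -> : \sum_o pr o * `|lepage o.1 o.2 b| `^ p =
   (S^-1) `^ p * \sum_o pr o * `|lepage o.1 o.2 (fun k => (w k)^-1 * a k : R^o)| `^ p.
  rewrite mulr_sumr; apply: eq_bigr => o _.
  by rewrite lE normrM (ger0_norm SV0) powRM// mulrCA.
have he : e `^ p <= (S^-1) `^ p * (e `^ p * \sum_k `|a k| `^ p).
  rewrite mulrCA ler_peMr ?powR_ge0// -(divff (lt0r_neq0 S0)) {1}/S mulr_suml.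
  rewrite mulr_sumr; apply: ler_sum => k _; rewrite -powRM// mulrC.
  have : 0 <= S^-1 * `|a k| by rewrite mulr_ge0.
  rewrite le_eqVlt => /predU1P[<-|h]; first exact: powR_ge0.
  apply: ger1_powR => //; rewrite h/= ler_pdivrMl// mulr1.
  by rewrite /S (bigD1 k)//= lerDl sumr_ge0.
move=> /le_trans/(_ (lerD (lexx _) he)); rewrite -mulrDr.
move: (_ + _) => T.
have -> : S `^ p = (c4 * S) `^ p * (20 ^- 2) `^ p.
  rewrite -powRM ?invr_ge0 ?exprn_ge0 ?mulr_ge0 ?(ltW S0)//; congr (_ `^ _).
  by rewrite c4E mulrAC divff ?mul1r// expf_neq0// pnatr_eq0.
move=> h; apply: le_trans (ler_wpM2l (powR_ge0 _ _) h) _.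
rewrite mulrA -powRM ?mulr_ge0 ?(ltW S0)//.
by rewrite mulfK ?gt_eqF.
Qed.

End TypeForms.

(** * Operators on a space with non-trivial type are 1-convex *)

Section NontrivialType.
Context (R : realType) (E : normedModType R).

(** This is the factorization condition of Maurey. The scalar inequality of
    [type_forms] passes to the lattice by functional calculus, and the
    p-convexity constant enters only once, so the scalar constant survives. *)
Lemma nontrivial_type_convex : nontrivial_type E -> exists2 C : R, 0 < C &
  forall p : R, 0 < p <= 1 -> forall X : pBanachLatticeType p, p_convex X ->
  forall (T : {linear E -> X}) (t : R), (forall x, pnorm (T x) <= t * `|x|) -> 0 <= t ->
  forall n (x : 'I_n -> E),
    pnorm (\sum_k vabs (T (x k))) <= C * p_convexity_const X * t * \sum_k `|x k|.
Proof.
move=> [q q1 [K typeK]].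
have K1 : 0 < Num.max K 1 by rewrite lt_max ltr01 orbT.
have [|C C0 hC] := @type_forms R E q (Num.max K 1) q1 K1.
  move=> n x; apply: le_trans (typeK n x) _.
  by rewrite ler_wpM2r ?powR_ge0// le_max lexx.
exists C => // p p01 X pX T t Tt t0 n x; have /andP[p0 p1] := p01.
set P := pnorm _; set M := p_convexity_const X.
have step c (h : R) : @p_convex_const R p X c -> 0 < h ->
    P <= c * (t * (C * \sum_k (`|x k| + h))).
  move=> [c0 Xc] h0.
  have [J [A [A1 A2]]] := hC p p01 n x (fun k => `|x k| + h)
    (fun k => ltr_wpDl (normr_ge0 _) h0) (fun k => (ler_wpDr (ltW h0) (lexx _))).
  pose B (j : 'I_#|J|) := A (enum_val j).
  have sumB (G : J -> R) : \sum_j G j = \sum_(j < #|J|) G (enum_val j).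
    by rewrite (reindex (@enum_val J predT))//; exact/onW_bij/enum_val_bij.
  have := @vl1_le_krivine R p p01 X #|J| n (fun k => T (x k)) B 1.
  rewrite scale1r => H.
  have a1 (a : 'I_n -> R) : \sum_k `|a k| <=
      1 * (\sum_j `|\sum_k B j k * a k| `^ p) `^ p^-1.
    by rewrite mul1r -(sumB (fun j => `|\sum_k A j k * a k| `^ p)).
  have {}H := H a1.
  apply: (@le_trans _ _ (pnorm (krivine (fun j => \sum_k B j k *: T (x k)) (@lp_fun R p #|J|)))).
    by apply: pnorm_ge0_le H; apply: vsum_ge0 => k; exact: vabs_ge0.
  apply: le_trans (Xc _ _) _; rewrite ler_pM2l//.
  apply: (@le_trans _ _ (t * (\sum_j `|\sum_k A j k *: x k| `^ p) `^ p^-1)); last first.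
    by rewrite ler_wpM2l.
  apply: (@powR_cancel_le _ p) => //; rewrite ?mulr_ge0 ?powR_ge0//.
  rewrite powRM ?powR_ge0// !powR_Vinv//; last 2 first.
  - by apply: sumr_ge0 => j _; exact: powR_ge0.
  - by apply: sumr_ge0 => j _; exact: powR_ge0.
  rewrite mulr_sumr sumB; apply: ler_sum => j _; rewrite -powRM//.
  apply: powR_le; rewrite ?pnorm_ge0//; first exact: ltW.
  have -> : \sum_k B j k *: T (x k) = T (\sum_k A (enum_val j) k *: x k).
    by rewrite linear_sum; apply: eq_bigr => k _; rewrite linearZ.
  exact: Tt.
have infS (d : R) : 0 <= d -> (forall c, @p_convex_const R p X c -> P <= c * d) -> P <= M * d.
  rewrite le_eqVlt => /predU1P[<-|d0] h.
    by have [c /h] := pX; rewrite !mulr0.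
  rewrite -ler_pdivrMr//; apply: lb_le_inf => // c /h.
  by rewrite ler_pdivrMr.
have M0 : 0 <= M by apply: lb_le_inf => // c [/ltW].
have x0 (h : R) : 0 < h -> 0 <= \sum_k (`|x k| + h).
  by move=> h0; apply: sumr_ge0 => k _; rewrite addr_ge0// ltW.
have lim (h : R) : 0 < h -> P <= M * (t * (C * \sum_k (`|x k| + h))).
  move=> h0; apply: infS => [|c hc]; last exact: step.
  by rewrite !mulr_ge0// ?(ltW C0)// x0.
apply/ler_addgt0Pr => e e0.
have d0 : 0 < M * t * C * n%:R + 1.
  by rewrite ltr_wpDl// !mulr_ge0// ltW.
apply: le_trans (lim _ (divr_gt0 e0 d0)) _.
have -> : \sum_k (`|x k| + e / (M * t * C * n%:R + 1)) =
    \sum_k `|x k| + n%:R * (e / (M * t * C * n%:R + 1)).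
  by rewrite big_split/= sumr_const card_ord mulr_natl.
have -> : M * (t * (C * (\sum_k `|x k| + n%:R * (e / (M * t * C * n%:R + 1))))) =
  C * M * t * \sum_k `|x k| + (M * t * C * n%:R) * e / (M * t * C * n%:R + 1) by ring.
rewrite lerD2l ler_pdivrMr// mulrC ler_pM2l// lerDl//.
Qed.

End NontrivialType.

(** * Complete normed sublattices *)

Section NormedSublattice.
Context (R : realType) (p : R) (X : pBanachLatticeType p).

(** Completeness of such a space follows from the last two laws: a Cauchy sequence
    converges in [X], and closedness of the balls turns this into convergence
    for the finer norm. *)
Record normed_sublattice := NormedSublattice {
  ns_mem : set X;
  ns_norm : X -> R;
  ns_cst : R;
  ns_mem0 : ns_mem 0;
  ns_memD : forall (a : R) x y, ns_mem x -> ns_mem y -> ns_mem (a *: x + y);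
  ns_mem_join : forall x y, ns_mem x -> ns_mem y -> ns_mem (vjoin x y);
  ns_norm_ge0 : forall x, ns_mem x -> 0 <= ns_norm x;
  ns_normZ : forall a x, ns_mem x -> ns_norm (a *: x) = `|a| * ns_norm x;
  ns_normD : forall x y, ns_mem x -> ns_mem y ->
    ns_norm (x + y) <= ns_norm x + ns_norm y;
  ns_norm_solid : forall x y, ns_mem x -> ns_mem y -> vabs x <= vabs y ->
    ns_norm x <= ns_norm y;
  ns_norm_bound : forall x, ns_mem x -> pnorm x <= ns_cst * ns_norm x;
  ns_closed : forall (u : nat -> X) l s,
    (forall n, ns_mem (u n) /\ ns_norm (u n) <= s) -> ncvg u l ->
    ns_mem l /\ ns_norm l <= s
}.

Context (S : normed_sublattice).

Definition ns_pred : {pred X} := fun x => `[< ns_mem S x >].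

Record ns_type := NsType { ns_val : X; _ : ns_val \in ns_pred }.

HB.instance Definition _ := [isSub for ns_val].
HB.instance Definition _ := [Choice of ns_type by <:].

Fact ns_submod : submod_closed ns_pred.
Proof.
split=> [|a x y]; first exact/asboolP/ns_mem0.
by move=> /asboolP Sx /asboolP Sy; exact/asboolP/ns_memD.
Qed.
HB.instance Definition _ := GRing.isSubmodClosed.Build R X ns_pred ns_submod.
HB.instance Definition _ := [SubChoice_isSubLmodule of ns_type by <:].
HB.instance Definition _ :=
  [SubChoice_isSubPOrder of ns_type by <: with ring_display].

Lemma ns_valP (x : ns_type) : ns_mem S (ns_val x).
Proof. by case: x => x /= /asboolP. Qed.

Definition to_ns x (Sx : ns_mem S x) : ns_type := @NsType x (asboolT Sx).

Lemma ns_mem_meet x y : ns_mem S x -> ns_mem S y -> ns_mem S (vmeet x y).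
Proof.
have memN z : ns_mem S z -> ns_mem S (- z).
  by move=> Sz; have := ns_memD (-1) Sz (ns_mem0 S); rewrite scaleN1r addr0.
by move=> Sx Sy; rewrite vmeetE; apply/memN/ns_mem_join; exact: memN.
Qed.

Definition ns_join (x y : ns_type) := to_ns (ns_mem_join (ns_valP x) (ns_valP y)).
Definition ns_meet (x y : ns_type) := to_ns (ns_mem_meet (ns_valP x) (ns_valP y)).

Lemma ns_val_le (x y : ns_type) : (x <= y) = (ns_val x <= ns_val y).
Proof. by []. Qed.

Fact ns_join_le (x y z : ns_type) : (ns_join x y <= z) = (x <= z) && (y <= z).
Proof. by rewrite !ns_val_le vjoin_le. Qed.
Fact ns_le_meet (x y z : ns_type) : (z <= ns_meet x y) = (z <= x) && (z <= y).
Proof. by rewrite !ns_val_le le_vmeet. Qed.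
Fact ns_leD2r (x y z : ns_type) : x <= y -> x + z <= y + z.
Proof. by rewrite !ns_val_le vleD2r. Qed.
Fact ns_leZ (a : R) (x y : ns_type) : 0 <= a -> x <= y -> a *: x <= a *: y.
Proof. by move=> a0; rewrite !ns_val_le; exact: vleZ. Qed.

HB.instance Definition _ :=
  POrderedLmodule_isVectorLattice.Build R ns_type ns_join_le ns_le_meet ns_leD2r ns_leZ.

Let N (x : ns_type) : R := ns_norm S (ns_val x).

Let N0 (x : ns_type) : 0 <= N x. Proof. exact/ns_norm_ge0/ns_valP. Qed.

Let NZ (a : R) (x : ns_type) : N (a *: x) = `|a| * N x.
Proof. exact/ns_normZ/ns_valP. Qed.

Let ND (x y : ns_type) : N (x + y) <= N x + N y.
Proof. by apply: ns_normD; exact: ns_valP. Qed.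

Let Neq0 (x : ns_type) : N x = 0 -> x = 0.
Proof.
move=> x0; apply/val_inj/pnorm_eq0/le_anti; rewrite pnorm_ge0 andbT.
by apply: le_trans (ns_norm_bound (ns_valP x)) _; rewrite -/(N x) x0 mulr0.
Qed.

Let NB (x y : ns_type) : N (x - y) = N (y - x).
Proof. by rewrite -opprB -scaleN1r NZ normrN1 mul1r. Qed.

Let Nxx (x : ns_type) : N (x - x) = 0.
Proof. by rewrite subrr -(scale0r (0 : ns_type)) NZ normr0 mul0r. Qed.

Let Nsub0 (x y : ns_type) : N (x - y) = 0 -> x = y.
Proof. by move/Neq0/eqP; rewrite subr_eq0 => /eqP. Qed.

Let Ntri (y x z : ns_type) : N (x - z) <= N (x - y) + N (y - z).
Proof. by rewrite -(subrKA y) ND. Qed.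

HB.instance Definition _ := @isMetric.Build R ns_type (fun x y => N (x - y))
  Nxx Nsub0 NB Ntri.

Fact ns_pnormD (x y : ns_type) : N (x + y) `^ 1 <= N x `^ 1 + N y `^ 1.
Proof. by rewrite !powRr1. Qed.

Fact ns_solid (x y : ns_type) : vabs x <= vabs y -> N x <= N y.
Proof. by move=> xy; apply: ns_norm_solid; [exact: ns_valP|exact: ns_valP|exact: xy]. Qed.

Fact ns_entourageE : entourage =
  entourage_ (fun (x : ns_type) (e : R) => [set y | N (x - y) < e]).
Proof. by []. Qed.

Fact ns_complete (F : set_system ns_type) : ProperFilter F -> cauchy F ->
  exists l : ns_type, F --> l.
Proof.
move=> PF cF.
have entN e : 0 < e -> entourage [set xy : ns_type * ns_type | N (xy.1 - xy.2) < e].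
  by move=> e0; rewrite ns_entourageE; exists e.
have small (e : R) : 0 < e -> exists m, forall k, (m <= k)%N -> k.+1%:R^-1 < e.
  move=> e0; have [m _ hm] := near_infty_natSinv_lt (PosNum e0).
  by exists m => k /hm.
have exA k : exists A, F A /\ forall x y, A x -> A y -> N (x - y) < k.+1%:R^-1.
  have k0 : 0 < k.+1%:R^-1 :> R by rewrite invr_gt0.
  have [[A B]/= [FA FB] AB] := cF _ (entN _ k0).
  exists (A `&` B); split; first exact: filterI.
  by move=> x y [Ax _] [_ By]; exact: (AB (x, y)).
have {exA}[A hA] := choice exA.
have exx k : exists x, forall j, (j <= k)%N -> A j x.
  have : F [set x | forall j, (j <= k)%N -> A j x].
    elim: k => [|k IH].
      by apply: filterS (hA 0%N).1 => x Ax j; rewrite leqn0 => /eqP ->.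
    apply: filterS (filterI IH (hA k.+1).1) => x [h1 h2] j.
    by rewrite leq_eqVlt => /predU1P[->//|]; rewrite ltnS; exact: h1.
  by move=> /filter_ex.
have {exx}[x hx] := choice exx.
have xx m j k : (m <= j)%N -> (m <= k)%N -> N (x j - x k) < m.+1%:R^-1.
  by move=> mj mk; apply: (hA m).2; exact: hx.
pose b := `|ns_cst S| + 1; have b0 : 0 < b by rewrite ltr_wpDl.
have [l xl] : exists l, ncvg (fun k => ns_val (x k)) l.
  apply: ncauchy_cvg => e e0; have [m hm] := small _ (divr_gt0 e0 b0).
  exists m => j k mj mk; apply: le_lt_trans (ns_norm_bound (ns_valP (x j - x k))) _.
  apply: (@le_lt_trans _ _ (b * N (x j - x k))).
    apply: ler_wpM2r; first exact: N0.
    by rewrite (le_trans (ler_norm _))// /b lerDl.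
  rewrite mulrC -ltr_pdivlMr//; apply: lt_trans (xx m j k mj mk) _.
  exact: hm.
have dl m : ns_mem S (ns_val (x m) - l) /\ ns_norm S (ns_val (x m) - l) <= m.+1%:R^-1.
  apply: (@ns_closed S (fun k => ns_val (x m) - ns_val (x (k + m)%N))).
    move=> k; split; first exact: (ns_valP (x m - x (k + m)%N)).
    by apply/ltW/xx => //; exact: leq_addl.
  move=> e /xl[M hM]; exists M => k Mk; rewrite opprB addrC addrA subrK -opprB pnormN.
  by apply: hM; exact: leq_trans (leq_addr _ _).
have Sl : ns_mem S l.
  have := ns_memD (-1) (dl 0%N).1 (ns_valP (x 0%N)).
  by rewrite scaleN1r opprB subrK.
exists (to_ns Sl) => U /nbhsP[V /=]; rewrite ns_entourageE => -[e /= e0 eV] VU.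
have [|m hm] := small (e / 2); first by rewrite divr_gt0.
apply: filterS (hA m).1 => y Ay; apply: VU; rewrite /xsection/= inE; apply: eV => /=.
apply: le_lt_trans (Ntri (x m) _ _) _; rewrite (splitr e); apply: ltr_leD.
  rewrite NB; apply: le_lt_trans (hm m (leqnn _)); exact: (dl m).2.
apply: ltW; apply: lt_trans (hm m (leqnn _)).
by apply: (hA m).2 => //; exact: hx.
Qed.

HB.instance Definition _ := @VectorLattice_isPBanach.Build R 1 ns_type N
  N0 Neq0 NZ ns_pnormD ns_solid ns_entourageE ns_complete.

Lemma ns_pnormE (x : ns_type) : pnorm x = ns_norm S (ns_val x).
Proof. by []. Qed.

End NormedSublattice.

(** * Extension of bounded operators to the free Banach lattice *)

Section BoundedOperators.
Context (R : realType) (E : normedModType R) (p : R) (X : pBanachLatticeType p).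

Lemma bounded_continuous (T : {linear E -> X}) (c : R) :
  (forall x, pnorm (T x) <= c * `|x|) -> continuous T.
Proof.
move=> Tc x U /nbhs_pnormP[e e0 eU].
have c0 : 0 < `|c| + 1 by rewrite ltr_wpDl.
apply/nbhs_ballP; exists (e / (`|c| + 1)); first exact: divr_gt0.
move=> y /=; rewrite -ball_normE/= => xy; apply: eU; rewrite -linearB.
apply: le_lt_trans (Tc _) _; apply: (@le_lt_trans _ _ ((`|c| + 1) * `|x - y|)).
  by rewrite ler_wpM2r// (le_trans (ler_norm _))// lerDl.
by rewrite mulrC -ltr_pdivlMr.
Qed.

Lemma continuous_bounded (T : {linear E -> X}) : continuous T ->
  exists2 t : R, 0 <= t &
    opnorm Num.norm pnorm T = t%:E /\ forall x, pnorm (T x) <= t * `|x|.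
Proof.
move=> Tc.
have [d d0 dT] : exists2 d : R, 0 < d & forall x, `|x| < d -> pnorm (T x) < 1.
  have /nbhs_ballP[d d0 dT] := Tc 0 _ (nbhs_pnorm (T 0) (@ltr01 R)).
  exists d => // x xd; have := dT x; rewrite -ball_normE/= sub0r normrN => /(_ xd).
  by rewrite linear0 sub0r pnormN.
have bnd x : `|x| <= 1 -> pnorm (T x) <= 2 / d.
  move=> x1; have : pnorm (T ((d / 2) *: x)) < 1.
    apply: dT; rewrite normrZ ger0_norm; last by rewrite divr_ge0// ltW.
    apply: (@le_lt_trans _ _ (d / 2)); first by rewrite ler_piMr// divr_ge0// ltW.
    by lra.
  rewrite linearZ pnormZ ger0_norm; last by rewrite divr_ge0// ltW.
  by rewrite -ltr_pdivlMl ?divr_gt0// mulr1 invf_div => /ltW.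
have ub : (opnorm Num.norm pnorm T <= (2 / d)%:E)%E.
  by apply: ge_ereal_sup => _ [x /= x1 <-]; rewrite lee_fin bnd.
have lb x : `|x| <= 1 -> ((pnorm (T x))%:E <= opnorm Num.norm pnorm T)%E.
  by move=> x1; apply: ereal_sup_ubound; exists x.
have := lb 0; rewrite normr0 linear0 pnorm0 => /(_ ler01).
move: ub lb; case: (opnorm _ _ _) => [t _ lb|//|//]; rewrite lee_fin => t0.
exists t => //; split=> // x; have [->|x0] := eqVneq x 0.
  by rewrite linear0 pnorm0 normr0 mulr0.
have nx : 0 < `|x| by rewrite normr_gt0.
have := lb (`|x|^-1 *: x); rewrite normrZ normfV normr_id mulVf ?gt_eqF// lexx => /(_ isT).
rewrite lee_fin linearZ pnormZ normfV normr_id ler_pdivrMl//.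
by rewrite mulrC.
Qed.

End BoundedOperators.

Section Corestriction.
Context (R : realType) (E : normedModType R) (p : R) (X : pBanachLatticeType p).
Context (S : normed_sublattice X) (T : {linear E -> X}).
Context (memT : forall x, ns_mem S (T x)).

Definition corestr (x : E) : ns_type S := to_ns (memT x).

Fact corestr_linear : linear corestr.
Proof. by move=> a x y; apply/val_inj => /=; rewrite linearP. Qed.

HB.instance Definition _ := GRing.isLinear.Build R E (ns_type S) _ corestr corestr_linear.

End Corestriction.

Section Factorization.
Context (R : realType) (E : completeNormedModType R) (F : pBanachLatticeType (1 : R)).
Context (delta : {linear E -> F}) (hF : is_FBL delta).

(** The universal property concerns Banach lattices only; it applies to [T] because
    the normed sublattice is one. *)
Lemma fbl_extend_sublattice (p : R) (X : pBanachLatticeType p)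
    (S : normed_sublattice X) (T : {linear E -> X}) :
  (forall x, ns_mem S (T x) /\ ns_norm S (T x) <= `|x|) ->
  exists That : F -> X, [/\ lattice_hom_extension delta T That,
    forall f, ns_mem S (That f) &
    forall f, pnorm f <= 1 -> ns_norm S (That f) <= 1].
Proof.
move=> hT; have memT x := (hT x).1.
have cT : continuous (corestr memT).
  apply: (@bounded_continuous _ _ _ _ _ 1) => x.
  by rewrite mul1r ns_pnormE; exact: (hT x).2.
have [That [[[[linT joinT meetT] eT] _] nT]] := hF.2 _ _ cT.
exists (fun f => ns_val (That f)); split.
- split; last by move=> x; rewrite eT.
  split=> [a f g|f g|f g].
  + by rewrite linT.
  + by rewrite joinT.
  + by rewrite meetT.
- by move=> f; exact: ns_valP.
- move=> f f1; rewrite -ns_pnormE -lee_fin.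
  apply: (@le_trans _ _ (opnorm pnorm pnorm That)).
    by apply: ereal_sup_ubound; exists f.
  rewrite nT; apply: ge_ereal_sup => _ [x /= x1 <-].
  by rewrite lee_fin (le_trans (hT x).2).
Qed.

End Factorization.

(** * Uniqueness of the extension *)

Section LatticeHom.
Context (R : realType) (V W : vectorLatticeType R) (S : V -> W) (hS : lattice_hom S).

Lemma lattice_homD a x y : S (a *: x + y) = a *: S x + S y.
Proof. by case: hS => ->. Qed.

Lemma lattice_hom0 : S 0 = 0.
Proof. by have := lattice_homD (-1) 0 0; rewrite scaler0 addr0 scaleN1r addNr. Qed.

Lemma lattice_homZ a x : S (a *: x) = a *: S x.
Proof. by have := lattice_homD a x 0; rewrite lattice_hom0 !addr0. Qed.

Lemma lattice_homB x y : S (x - y) = S x - S y.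
Proof. by have := lattice_homD (-1) y x; rewrite !scaleN1r ![- _ + _]addrC. Qed.

Lemma lattice_hom_abs x : S (vabs x) = vabs (S x).
Proof. by case: hS => _ hj _; rewrite /vabs hj -scaleN1r lattice_homZ scaleN1r. Qed.

Lemma lattice_hom_le x y : x <= y -> S x <= S y.
Proof.
case: hS => _ hj _ xy; have := hj x y.
by rewrite (vjoinC x) vjoin_l// => ->; exact: vjoin_lel.
Qed.

End LatticeHom.

Section AutomaticBoundedness.
Context (R : realType) (F : pBanachLatticeType (1 : R)) (p : R) (X : pBanachLatticeType p).

Let one01 : 0 < (1 : R) <= 1. Proof. by rewrite ltr01 lexx. Qed.

Lemma pnorm1D (f g : F) : pnorm (f + g) <= pnorm f + pnorm g.
Proof. by have := pnormD f g; rewrite !powRr1 ?pnorm_ge0. Qed.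

(** Otherwise there are nonnegative elements with summable norms and unbounded
    images, and the image of their sum dominates all these images. *)
Lemma lattice_hom_bounded (S : F -> X) : lattice_hom S ->
  exists c : R, forall f, pnorm (S f) <= c * pnorm f.
Proof.
move=> hS; apply: contrapT => unb.
have exg (k : nat) : exists g : F, [/\ 0 <= g, pnorm g <= 2 ^- k & k%:R <= pnorm (S g)].
  have [f hf] : exists f, k%:R * 2 ^+ k * pnorm f < pnorm (S f).
    apply: contrapT => h; apply: unb; exists (k%:R * 2 ^+ k) => f.
    by rewrite leNgt; apply/negP => hf; apply: h; exists f.
  have f0 : 0 < pnorm f.
    rewrite lt_neqAle pnorm_ge0 andbT eq_sym; apply/eqP => /pnorm_eq0 f0.
    by move: hf; rewrite f0 (lattice_hom0 hS) !pnorm0 mulr0 ltxx.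
  have a0 : 0 <= (2 ^+ k * pnorm f)^-1.
    by rewrite invr_ge0 mulr_ge0 ?exprn_ge0// pnorm_ge0.
  have k0 : 0 < 2 ^+ k :> R by rewrite exprn_gt0.
  exists ((2 ^+ k * pnorm f)^-1 *: vabs f); split.
  - by rewrite vscale_ge0// vabs_ge0.
  - by rewrite pnormZ ger0_norm// pnorm_abs invfM -mulrA mulVf ?mulr1// gt_eqF.
  - rewrite (lattice_homZ hS) (lattice_hom_abs hS) pnormZ pnorm_abs ger0_norm//.
    by rewrite ler_pdivlMl ?mulr_gt0// mulrC mulrA ltW.
have [g hg] := choice exg.
pose u n := \sum_(k < n) g k.
have uS n : u n.+1 = u n + g n by rewrite /u big_ord_recr.
have du n m : pnorm (u (n + m)%N - u n) <= 2 * 2 ^- n.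
  suff H : pnorm (u (n + m)%N - u n) <= 2 * 2 ^- n - 2 * 2 ^- (n + m).
    by apply: le_trans H _; rewrite lerBlDr lerDl mulr_ge0// invr_ge0 exprn_ge0.
  elim: m => [|m IH]; first by rewrite addn0 !subrr pnorm0.
  rewrite addnS uS addrAC; apply: le_trans (pnorm1D _ _) _.
  have [_ gm _] := hg (n + m)%N.
  have -> : 2 * 2 ^- (n + m).+1 = 2 ^- (n + m) :> R.
    by rewrite exprS invfM mulrA divff ?mul1r// pnatr_eq0.
  by apply: le_trans (lerD IH gm) _; lra.
have [l ul] : exists l, ncvg u l.
  apply: ncauchy_cvg => e e0.
  have [N hN] : exists N, 4 * 2 ^- N < e.
    exists (Num.bound (4 / e)); rewrite ltr_pdivrMr ?exprn_gt0//.
    rewrite mulrC -ltr_pdivrMr//.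
    exact: upper_nthrootP.
  exists N => m n Nm Nn; rewrite -(subnKC Nm) -(subnKC Nn) -(subrKA (u N)).
  apply: le_lt_trans (pnorm1D _ _) _; rewrite [pnorm (u N - _)]pnormB.
  by apply: le_lt_trans (lerD (du _ _) (du _ _)) _; lra.
have gl k : g k <= l.
  have uk n : g k <= u (n + k.+1)%N.
    elim: n => [|n IH].
      rewrite add0n uS -[X in X <= _]add0r vleD2r; apply: vsum_ge0 => i.
      by have [] := hg i.
    rewrite addSn uS; apply: le_trans IH _; rewrite -[X in X <= _]addr0 vleD2l.
    by have [] := hg (n + k.+1)%N.
  apply: (ncvg_le one01 uk (ncvg_cst (g k))).
  by move=> e /ul[N hN]; exists N => n Nn; apply: hN; exact: leq_trans (leq_addr _ _).
have Sl k : k%:R <= pnorm (S l).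
  have [g0 _ hk] := hg k; apply: le_trans hk _; apply: pnorm_ge0_le.
    by rewrite -(lattice_hom0 hS); exact: lattice_hom_le hS _ _ g0.
  exact: lattice_hom_le hS _ _ (gl k).
have := archi_boundP (pnorm_ge0 (S l)).
by rewrite ltNge Sl.
Qed.

End AutomaticBoundedness.

Section Uniqueness.
Context (R : realType) (E : completeNormedModType R) (F : pBanachLatticeType (1 : R)).
Context (delta : {linear E -> F}) (hF : is_FBL delta).
Context (p : R) (hp : 0 < p <= 1) (X : pBanachLatticeType p).

Let one01 : 0 < (1 : R) <= 1. Proof. by rewrite ltr01 lexx. Qed.

Lemma lattice_hom_ncvg (S : F -> X) u l : lattice_hom S -> ncvg u l ->
  ncvg (fun n => S (u n)) (S l).
Proof.
move=> hS ul e e0; have [c hc] := lattice_hom_bounded hS.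
have c0 : 0 < `|c| + 1 by rewrite ltr_wpDl.
have [N hN] := ul _ (divr_gt0 e0 c0); exists N => n /hN h.
rewrite -(lattice_homB hS); apply: le_lt_trans (hc _) _.
apply: (@le_lt_trans _ _ ((`|c| + 1) * pnorm (u n - l))).
  by rewrite ler_wpM2r ?pnorm_ge0// (le_trans (ler_norm _))// lerDl.
by rewrite mulrC -ltr_pdivlMr.
Qed.

Section Equalizer.
Context (S1 S2 : F -> X) (h1 : lattice_hom S1) (h2 : lattice_hom S2).

Program Definition equalizer : normed_sublattice F :=
  @NormedSublattice R 1 F [set f | S1 f = S2 f] pnorm 1 _ _ _ _ _ _ _ _ _.
Next Obligation. by rewrite /= !lattice_hom0. Qed.
Next Obligation. by move=> a f g /= e1 e2; rewrite (lattice_homD h1) (lattice_homD h2) e1 e2. Qed.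
Next Obligation. by move=> f g /= e1 e2; case: h1 => _ -> _; case: h2 => _ -> _; rewrite e1 e2. Qed.
Next Obligation. by move=> f _; exact: pnorm_ge0. Qed.
Next Obligation. by move=> a f _; exact: pnormZ. Qed.
Next Obligation. by move=> f g _ _; exact: pnorm1D. Qed.
Next Obligation. by move=> f g _ _; exact: pnorm_solid. Qed.
Next Obligation. by move=> f _; rewrite mul1r. Qed.
Next Obligation.
move=> u l s /= us ul; split; last by apply: (ncvg_pnorm_le one01 _ ul) => n; case: (us n).
apply: (ncvg_unique hp (lattice_hom_ncvg h1 ul)).
rewrite (_ : (fun _ => _) = fun n => S2 (u n)); first exact: lattice_hom_ncvg.
by apply/funext => n; case: (us n).
Qed.

End Equalizer.

(** The equalizer of two extensions is a Banach lattice that contains the range of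
    [delta]. The extension of [delta] into it, seen as a map into [F], is the
    identity by uniqueness, so the equalizer is everything. *)
Lemma lattice_hom_extension_unique (T : E -> X) (S1 S2 : F -> X) :
  lattice_hom_extension delta T S1 -> lattice_hom_extension delta T S2 -> S1 = S2.
Proof.
move=> [h1 e1] [h2 e2].
have [|r [rext rmem _]] := @fbl_extend_sublattice _ _ _ _ hF 1 F (equalizer h1 h2) delta.
  by move=> x; split=> /=; rewrite ?e1 ?e2// hF.1.
have cd : continuous delta.
  by apply: (@bounded_continuous _ _ _ _ _ 1) => x; rewrite mul1r hF.1.
have [That [[_ Tu] _]] := hF.2 _ _ cd.
have rid : r = id by rewrite -(Tu r rext); apply: Tu; split.
by apply/funext => f; have := rmem f; rewrite rid.
Qed.

End Uniqueness.

(** * The Banach lattice generated by an operator *)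

Section GaugeIdeal.
Context (R : realType) (E : normedModType R) (p : R) (hp : 0 < p <= 1).
Context (X : pBanachLatticeType p) (T : {linear E -> X}) (c : R) (c0 : 0 <= c).
Context (Tc : forall n (x : 'I_n -> E),
  pnorm (\sum_k vabs (T (x k))) <= c * \sum_k `|x k|).

(** The unit ball of the sought Banach lattice is the closure in [X] of the solid
    convex hull of the image of the unit ball of [E]; closedness makes the gauge
    complete. *)
Definition solid_hull (s : R) (v : X) : Prop := exists n (x : 'I_n -> E),
  vabs v <= \sum_k vabs (T (x k)) /\ \sum_k `|x k| <= s.

Definition hull (s : R) (v : X) : Prop :=
  forall e, 0 < e -> exists2 u, solid_hull s u & pnorm (v - u) < e.

Lemma hull0 : hull 0 0.
Proof.
move=> e e0; exists 0; last by rewrite subrr pnorm0.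
by exists 0%N, (fun=> 0); rewrite !big_ord0 vabs0.
Qed.

Lemma hullW s r v : s <= r -> hull s v -> hull r v.
Proof.
move=> sr hv e /hv[u [n [x [ux xs]]] ve]; exists u => //; exists n, x.
by split=> //; exact: le_trans sr.
Qed.

Lemma hull_im x : hull `|x| (T x).
Proof.
move=> e e0; exists (T x); last by rewrite subrr pnorm0.
by exists 1%N, (fun=> x); rewrite !big_ord1.
Qed.

Lemma hullD s r v w : hull s v -> hull r w -> hull (s + r) (v + w).
Proof.
move=> hv hw e e0; have [d d0 hd] := pnormD_lt hp X e0.
have [a [n [x [ax xs]]] va] := hv d d0; have [b [m [y [b_y yr]]] wb] := hw d d0.
exists (a + b); last by rewrite opprD addrACA hd.
pose z (k : 'I_(n + m)) := match fintype.split k with inl i => x i | inr j => y j end.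
have zl i : z (lshift m i) = x i by rewrite /z (unsplitK (inl i)).
have zr j : z (rshift n j) = y j by rewrite /z (unsplitK (inr j)).
exists (n + m)%N, z; rewrite !big_split_ord/=; split.
  by apply: le_trans (vabsD _ _) _; apply: vleD;
    [under eq_bigr do rewrite zl|under eq_bigr do rewrite zr].
by apply: lerD; [under eq_bigr do rewrite zl|under eq_bigr do rewrite zr].
Qed.

Lemma hullZ s a v : hull s v -> hull (`|a| * s) (a *: v).
Proof.
move=> hv e e0; have a0 : 0 < `|a| + 1 by rewrite ltr_wpDl.
have [u [n [x [ux xs]]] vu] := hv _ (divr_gt0 e0 a0).
exists (a *: u).
  exists n, (fun k => a *: x k); split.
    rewrite vabsZ; under eq_bigr do rewrite linearZ vabsZ.
    by rewrite -scaler_sumr vleZ.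
  by under eq_bigr do rewrite normrZ; rewrite -mulr_sumr ler_wpM2l.
rewrite -scalerBr pnormZ; apply: (@le_lt_trans _ _ ((`|a| + 1) * pnorm (v - u))).
  by rewrite ler_wpM2r ?pnorm_ge0// lerDl.
by rewrite mulrC -ltr_pdivlMr.
Qed.

(** Truncating the approximations of [v] at the level of [w] approximates [w]. *)
Lemma hull_solid s v w : vabs w <= vabs v -> hull s v -> hull s w.
Proof.
move=> wv hv e e0; have e4 : 0 < e / 4 by rewrite divr_gt0.
have [u [n [x [ux xs]]] vu] := hv _ e4.
pose t z := vjoin (vmeet w (vabs z)) (- vabs z).
exists (t u).
  exists n, x; split=> //; apply: le_trans ux; rewrite vabs_le /t; apply/andP; split.
    apply: vjoinP; first exact: vmeet_ler.
    by rewrite (le_trans _ (vabs_ge0 u))// -vleN oppr0 opprK vabs_ge0.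
  by rewrite vleNl vjoin_ler.
have wt : w = t v.
  have /andP[h1 h2] : (w <= vabs v) && (- w <= vabs v) by rewrite -vabs_le.
  apply/le_anti/andP; split.
    by apply: le_trans (vjoin_lel _ _); exact: vmeetP.
  by apply: vjoinP; [exact: vmeet_lel|rewrite vleNl].
have absB : vabs (vabs v - vabs u) <= vabs (v - u) + vabs (v - u).
  apply: le_trans (vabs_joinB _ _ _ _) _.
  by rewrite vleD2l -opprD vabsN.
have : vabs (w - t u) <= 4 *: vabs (v - u).
  rewrite {1}wt; apply: le_trans (vabs_joinB _ _ _ _) _.
  rewrite -opprD vabsN.
  apply: (@le_trans _ _ (vabs (vabs v - vabs u) + vabs (vabs v - vabs u))).
    rewrite vleD2r; apply: le_trans (vabs_meetB _ _ _ _) _.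
    by rewrite subrr vabs0 add0r.
  apply: le_trans (vleD absB absB) _.
  have -> : 4 = 1 + 1 + (1 + 1) :> R by lra.
  by rewrite !scalerDl !scale1r.
move=> /pnorm_dom/le_lt_trans; apply.
by rewrite pnormZ pnorm_abs ger0_norm// -ltr_pdivlMl// mulrC.
Qed.

(** This is where the estimate on sums of moduli is needed: without it the gauge
    could vanish on nonzero elements. *)
Lemma hull_pnorm s v : hull s v -> pnorm v <= c * s.
Proof.
move=> hv; have p0 : 0 < p by case/andP: hp.
have exu (n : nat) : exists u, solid_hull s u /\ pnorm (v - u) < n.+1%:R^-1.
  by have [|u hu vu] := hv n.+1%:R^-1; [rewrite invr_gt0|exists u].
have [u hu] := choice exu.
apply: (ncvg_pnorm_le hp (u := u)).
  move=> n; have [[m [x [ux xs]]] _] := hu n.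
  by apply: le_trans (pnorm_dom ux) _; apply: le_trans (Tc x) _; rewrite ler_wpM2l.
move=> e e0; have [m _ hm] := near_infty_natSinv_lt (PosNum e0).
by exists m => k /hm /= h; rewrite pnormB; apply: lt_trans h; exact: (hu k).2.
Qed.

Lemma hull_closed s (u : nat -> X) l : (forall n, hull s (u n)) -> ncvg u l -> hull s l.
Proof.
move=> hu ul e e0; have [d d0 hd] := pnormD_lt hp X e0.
have [N hN] := ul _ d0; have [a ha ua] := hu N _ d0.
exists a => //; rewrite -(subrKA (u N)); apply: hd => //.
by rewrite pnormB hN.
Qed.

Definition gauge_mem : set X := [set v | exists s, hull s v].
Definition gauge (v : X) : R := inf [set s | hull s v].

Lemma hull_ge0 s v : hull s v -> 0 <= s.
Proof.
move=> /(_ 1 ltr01)[u [n [x [_ xs]]] _]; apply: le_trans xs.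
exact: sumr_ge0.
Qed.

Lemma gauge_le s v : hull s v -> gauge v <= s.
Proof. by move=> hv; apply: ge_inf => //; exists 0 => r; exact: hull_ge0. Qed.

Lemma gauge_ge v r : gauge_mem v -> (forall s, hull s v -> r <= s) -> r <= gauge v.
Proof. by move=> [s hv] h; apply: lb_le_inf => //; exists s. Qed.

Lemma gauge_lt v r : gauge_mem v -> gauge v < r -> hull r v.
Proof.
move=> [s hv] vr.
have [t ht tr] : exists2 t, hull t v & t < r.
  by apply: inf_lt vr => //; exists s.
exact: hullW (ltW tr) ht.
Qed.

Lemma gauge_mem_solid v w : vabs w <= vabs v -> gauge_mem v -> gauge_mem w.
Proof. by move=> wv [s hv]; exists s; exact: hull_solid hv. Qed.

Lemma gauge_memD a v w : gauge_mem v -> gauge_mem w -> gauge_mem (a *: v + w).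
Proof. by move=> [s hv] [r hw]; exists (`|a| * s + r); apply/hullD/hw/hullZ. Qed.

Lemma gauge_mem_join v w : gauge_mem v -> gauge_mem w -> gauge_mem (vjoin v w).
Proof.
move=> hv hw; apply: (@gauge_mem_solid (vabs v + vabs w)).
  rewrite [leRHS]vger0_abs ?vaddr_ge0 ?vabs_ge0//.
  have := vabs_joinB v w 0 0; rewrite !subr0.
  by rewrite (vjoin_l (lexx (0 : X))) subr0.
rewrite -[vabs v]scale1r; apply: gauge_memD;
  by [apply: gauge_mem_solid hv; rewrite vabs_abs|apply: gauge_mem_solid hw; rewrite vabs_abs].
Qed.

Lemma gaugeZ_le a v : gauge_mem v -> gauge (a *: v) <= `|a| * gauge v.
Proof.
move=> hv; apply/ler_addgt0Pr => e e0; have a0 : 0 < `|a| + 1 by rewrite ltr_wpDl.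
have : hull (gauge v + e / (`|a| + 1)) v by apply: gauge_lt; rewrite // ltrDl divr_gt0.
move=> /(hullZ a)/gauge_le/le_trans; apply; rewrite mulrDr lerD2l mulrA ler_pdivrMr//.
by rewrite mulrC ler_pM2l// lerDl.
Qed.

Lemma gaugeZ a v : gauge_mem v -> gauge (a *: v) = `|a| * gauge v.
Proof.
move=> hv; apply/le_anti; rewrite gaugeZ_le//=.
have [->|a0] := eqVneq a 0.
  rewrite normr0 mul0r; apply: gauge_ge => [|s]; last exact: hull_ge0.
  by rewrite scale0r; exists 0; exact: hull0.
have hav : gauge_mem (a *: v) by case: hv => s /(hullZ a); exists (`|a| * s).
have := gaugeZ_le a^-1 hav; rewrite scalerA mulVf// scale1r normfV.
by rewrite ler_pdivlMl ?normr_gt0.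
Qed.

Lemma gaugeD v w : gauge_mem v -> gauge_mem w -> gauge (v + w) <= gauge v + gauge w.
Proof.
move=> hv hw; apply/ler_addgt0Pr => e e0; have e2 : 0 < e / 2 by rewrite divr_gt0.
have h1 : hull (gauge v + e / 2) v by apply: gauge_lt; rewrite // ltrDl.
have h2 : hull (gauge w + e / 2) w by apply: gauge_lt; rewrite // ltrDl.
by apply: le_trans (gauge_le (hullD h1 h2)) _; lra.
Qed.

Lemma gauge_solid v w : gauge_mem v -> gauge_mem w -> vabs v <= vabs w ->
  gauge v <= gauge w.
Proof.
by move=> _ hw vw; apply: gauge_ge => // s hs; apply: gauge_le; exact: hull_solid hs.
Qed.

Lemma gauge_bound v : gauge_mem v -> pnorm v <= c * gauge v.
Proof.
move=> hv; apply/ler_addgt0Pr => e e0; have c1 : 0 < c + 1 by rewrite ltr_wpDl.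
have : hull (gauge v + e / (c + 1)) v by apply: gauge_lt; rewrite // ltrDl divr_gt0.
move=> /hull_pnorm/le_trans; apply; rewrite mulrDr lerD2l mulrA ler_pdivrMr//.
by rewrite mulrC ler_pM2l// lerDl.
Qed.

Lemma gauge_closed (u : nat -> X) l s :
  (forall n, gauge_mem (u n) /\ gauge (u n) <= s) -> ncvg u l ->
  gauge_mem l /\ gauge l <= s.
Proof.
move=> hu ul; have hl e : 0 < e -> hull (s + e) l.
  move=> e0; apply: hull_closed ul => n; have [h1 h2] := hu n.
  by apply: gauge_lt => //; apply: le_lt_trans h2 _; rewrite ltrDl.
split; first by exists (s + 1); exact: hl.
by apply/ler_addgt0Pr => e /hl; exact: gauge_le.
Qed.

Lemma gauge_mem0 : gauge_mem 0. Proof. by exists 0; exact: hull0. Qed.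

Lemma gauge_ge0 v : gauge_mem v -> 0 <= gauge v.
Proof. by move=> hv; apply: gauge_ge => // s; exact: hull_ge0. Qed.

Definition gauge_ideal : normed_sublattice X :=
  NormedSublattice gauge_mem0 gauge_memD gauge_mem_join gauge_ge0 gaugeZ gaugeD
    gauge_solid gauge_bound gauge_closed.

End GaugeIdeal.

Theorem corollary5p5 (R : realType) (E : completeNormedModType R)
    (hE : nontrivial_type E) :
  exists2 C : R, 0 < C &
  forall (F : pBanachLatticeType (1 : R)) (delta : {linear E -> F}),
    is_FBL delta ->
  forall (p : R), 0 < p <= 1 ->
  forall X : pBanachLatticeType p, p_convex X ->
  forall T : {linear E -> X}, continuous T ->
  exists That : F -> X,
    unique (lattice_hom_extension delta T) That /\
    (opnorm pnorm pnorm That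
       <= (C * p_convexity_const X)%:E * opnorm Num.norm pnorm T)%E.
Proof.
have [C C0 hC] := nontrivial_type_convex hE; exists C => //.
move=> F delta hF p hp X pX T cT.
have [t t0 [tE Tt]] := continuous_bounded cT.
have M0 : 0 <= p_convexity_const X by apply: lb_le_inf => // c [/ltW].
have c0 : 0 <= C * p_convexity_const X * t by rewrite !mulr_ge0// ltW.
have Tc := hC p hp X pX T t Tt t0.
have hT x : ns_mem (gauge_ideal hp c0 Tc) (T x) /\ ns_norm (gauge_ideal hp c0 Tc) (T x) <= `|x|.
  by split; [exists (`|x|)|apply: gauge_le]; exact: hull_im.
have [That [ext mem bnd]] := fbl_extend_sublattice hF hT.
exists That; split.
  split=> // That' ext'; exact: lattice_hom_extension_unique hF _ hp _ _ _ _ ext ext'.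
rewrite tE; apply: ge_ereal_sup => _ [f /= f1 <-]; rewrite lee_fin.
apply: le_trans (ns_norm_bound (mem f)) _.
by rewrite /= -[leRHS]mulr1 ler_wpM2l// bnd.
Qed.
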